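(* Let $u$ be the solution of the Poisson problem $-\Delta u=f$ in $\Omega$, $u=0$ on $\partial\Omega$, and let $u_h\in V_h$ be its finite element approximation, i.e. $a_h(u_h,v_h)=(f,v_h)$ for all $v_h\in V_h$. Assume there exist a subdomain $G\subset\subset\Omega$ such that $u\in W^{r+\delta,p}(G)$ $(\delta>0)$ and a multi-index $\gamma$ with $|\gamma|=r$ such that $\|D^\gamma u\|_{0,p,G}>0$ and $D^\gamma v_h=0$ for any $v_h\in V_h$. If the family $\{\mathcal{T}_h\}$ of partitions is quasi-uniform, the finite element solution $u_h$ has the following lower bound of the discretization error: $$\|u-u_h\|_{j,p,h}\ \ge\ C_{10}h^{r-j},\qquad 0\le j\le r,$$ where $1\le p\le\infty$ and $C_{10}$ is a positive constant, independent of the mesh size $h$ but dependent on $u$; and the error estimate $$\|u-u_h\|_{\ell,p,h}\le Ch^{s-\ell}\|u\|_{s,p},\qquad 0\le\ell\le1,\ 0<s\le r,\ 1<p<\infty,$$ is optimal for $s=r$ and $0\le\ell\le1$.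
   Context: $\Omega\subset\mathbb{R}^n$ ($n\ge1$) is a bounded polytopic domain with Lipschitz continuous boundary. $W^{s,p}(G)$ denotes the usual Sobolev space with norm $\|\cdot\|_{s,p,G}$ (the index $G$ is dropped when $G=\Omega$); $D^\alpha$ is the partial derivative of multi-index $\alpha$ and $|\alpha|=\sum_i\alpha_i$. $G\subset\subset\Omega$ means $G\subset\Omega$, $\mathrm{dist}(\partial\Omega,G)>0$ and $\mathrm{meas}(G)>0$. $(\cdot,\cdot)$ is the $L^2(\Omega)$ inner product; $f$ is a given right-hand side. $\mathcal{T}_h$ is a face-to-face partition of $\Omega$ into elements $K$ (triangles, rectangles, tetrahedra, bricks, etc.), so $\bar\Omega=\bigcup_{K\in\mathcal{T}_h}K$; $h_K=\mathrm{diam}\,K$ and $h=\max_{K\in\mathcal{T}_h}h_K$. A family $\{\mathcal{T}_h\}$ is regular if there is $\sigma>0$ with $h_K/\tau_K<\sigma$ for all $K\in\mathcal{T}_h$, where $\tau_K$ is the maximum diameter of an inscribed ball in $K$. A regular family is quasi-uniform if there is $\beta>0$ with $\max\{h/h_K: K\in\mathcal{T}_h\}\le\beta$. $V_h$ is a suitable finite element space (conforming or nonconforming for the second order elliptic problem) of piecewise polynomials of degree less than $r$ ($r\ge1$ an integer) on $\mathcal{T}_h$; derivatives of $v_h\in V_h$ are taken element by element, and $a_h(u_h,v_h)=\sum_{K\in\mathcal{T}_h}\int_K\nabla u_h\cdot\nabla v_h\,dK$. The displayed upper error estimate is the one known from the standard error theory of the finite element method. The piecewise seminorms are $|v|_{j,p,h}=\big(\sum_{K\in\mathcal{T}_h}\int_K\sum_{|\alpha|=j}|D^\alpha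 v|^p\,dK\big)^{1/p}$ for $1\le p<\infty$ and $|v|_{j,\infty,h}=\max_{K\in\mathcal{T}_h}|v|_{j,\infty,K}$; $\|v\|_{j,p,h}$ is the corresponding piecewise full norm, containing the seminorms of all orders $0,\dots,j$. *)

(* Defs.v *)
From HB Require Import structures.
From mathcomp Require Import all_boot all_order all_algebra.
From mathcomp Require Import all_classical all_reals all_analysis.

Set Implicit Arguments.
Unset Strict Implicit.
Unset Printing Implicit Defensive.

Import Order.TTheory GRing.Theory Num.Theory.
Import numFieldNormedType.Exports.

Local Open Scope classical_set_scope.
Local Open Scope ring_scope.

Fact rV_measure_display : measure_display. Proof. exact: default_measure_display. Qed.

Section measurable_rV.
Variables (R : realType) (n : nat).

Let coor (i : 'I_n) (x : 'rV[R]_n) : R := x 0 i.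

Let rV_set0 : g_sigma_preimage coor set0.
Proof. exact: sigma_algebra0. Qed.

Let rV_setC A : g_sigma_preimage coor A -> g_sigma_preimage coor (~` A).
Proof. exact: sigma_algebraC. Qed.

Let rV_bigcup (F : (set 'rV[R]_n)^nat) : (forall i, g_sigma_preimage coor (F i)) ->
  g_sigma_preimage coor (\bigcup_i (F i)).
Proof. exact: sigma_algebra_bigcup. Qed.

HB.instance Definition _ := @isMeasurable.Build rV_measure_display
  'rV[R]_n (g_sigma_preimage coor) rV_set0 rV_setC rV_bigcup.

Lemma measurable_coor i : measurable_fun [set: 'rV[R]_n] (fun x => x 0 i).
Proof.
move=> _ Y mY; rewrite setTI; apply: sub_sigma_algebra => /=.
rewrite -bigcup_seq/=; exists i => /=; first by rewrite mem_index_enum.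
by exists Y => //; rewrite setTI.
Qed.

Lemma measurable_fun_rV d (T : measurableType d) (f : T -> 'rV[R]_n) :
  (forall i, measurable_fun [set: T] (fun t => f t 0 i)) ->
  measurable_fun [set: T] f.
Proof.
move=> mf; suff H : preimage_set_system [set: T] f (g_sigma_preimage coor)
    `<=` measurable by move=> _ A mA; apply: H; exists A.
rewrite -g_sigma_preimage_comp.
apply: smallest_sub; first exact: sigma_algebra_measurable.
move=> A; rewrite -bigcup_seq => -[i _ [B mB <-]].
exact: mf.
Qed.

End measurable_rV.

Section lebesgue_rV.
Variable R : realType.

Definition rV_cons n (z : R * 'rV[R]_n) : 'rV[R]_n.+1 :=
  \row_i if unlift ord0 i is Some j then z.2 0 j else z.1.

Definition rV_uncons n (x : 'rV[R]_n.+1) : R * 'rV[R]_n :=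
  (x 0 ord0, \row_i x 0 (lift ord0 i)).

Lemma rV_consK n : cancel (@rV_cons n) (@rV_uncons n).
Proof.
move=> [a y]; rewrite /rV_cons /rV_uncons/= mxE unlift_none; congr pair.
by apply/rowP => i; rewrite !mxE liftK.
Qed.

Lemma rV_unconsK n : cancel (@rV_uncons n) (@rV_cons n).
Proof.
move=> x; apply/rowP => i; rewrite mxE.
by case: unliftP => [j|] -> //=; rewrite mxE.
Qed.

Lemma measurable_rV_cons n : measurable_fun [set: R * 'rV[R]_n] (@rV_cons n).
Proof.
apply: measurable_fun_rV => i; under eq_fun do rewrite mxE.
case: unliftP => [j|] _; last exact: measurable_fst.
exact: (measurableT_comp (measurable_coor (R:=R) j) measurable_snd).
Qed.

Lemma measurable_rV_uncons n : measurable_fun [set: 'rV[R]_n.+1] (@rV_uncons n).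
Proof.
apply: measurable_fun_pair; first exact: measurable_coor.
apply: measurable_fun_rV => i; under eq_fun do rewrite mxE.
exact: measurable_coor.
Qed.

HB.instance Definition _ n := isMeasurableFun.Build _ _ _ _ (@rV_cons n)
  (@measurable_rV_cons n).

Section lebesgue_step.
Variables (n : nat) (mu : {sigma_finite_measure set 'rV[R]_n -> \bar R}).

Definition lebesgue_step : set 'rV[R]_n.+1 -> \bar R :=
  pushforward (@lebesgue_measure R \x mu)%E (@rV_cons n).

Let step0 : lebesgue_step set0 = 0%E.
Proof. by rewrite /lebesgue_step /pushforward preimage_set0 measure0. Qed.

Let step_ge0 A : (0 <= lebesgue_step A)%E.
Proof. exact: (measure_ge0 (@lebesgue_measure R \x mu)%E). Qed.

Let step_sigma_additive : semi_sigma_additive lebesgue_step.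
Proof.
exact: (@measure_semi_sigma_additive _ _ _
  (measure_function_pushforward__canonical__measure_function_Measure
    (@lebesgue_measure R \x mu)%E (@measurable_rV_cons n))).
Qed.

HB.instance Definition _ := isMeasure.Build _ _ _
  lebesgue_step step0 step_ge0 step_sigma_additive.

Let step_sigma_finite : sigma_finite setT lebesgue_step.
Proof.
have /sigma_finiteP[F [TF ndF Foo]] := sigma_finiteT (@lebesgue_measure R).
have /sigma_finiteP[G [TG ndG Goo]] := sigma_finiteT mu.
exists (fun k => @rV_uncons n @^-1` (F k `*` G k)).
  apply/esym; rewrite -subTset => x _; pose z := rV_uncons x.
  have [k _ Fk] : (\bigcup_k F k) z.1 by rewrite -TF.
  have [l _ Gl] : (\bigcup_k G k) z.2 by rewrite -TG.
  exists (maxn k l) => //; split.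
    by move: Fk; exact/subsetPset/ndF/leq_maxl.
  by move: Gl; exact/subsetPset/ndG/leq_maxr.
move=> k; have [mF Fk] := Foo k; have [mG Gk] := Goo k; split.
  rewrite -[X in measurable X]setTI; apply: measurable_rV_uncons => //.
  exact: measurableX.
rewrite /lebesgue_step /pushforward -comp_preimage.
rewrite (_ : _ \o _ = idfun) ?preimage_id; last first.
  by apply/funext => z; exact: rV_consK.
by rewrite product_measure1E// lte_mul_pinfty// ge0_fin_numE.
Qed.

HB.instance Definition _ := Measure_isSigmaFinite.Build _ _ _
  lebesgue_step step_sigma_finite.

End lebesgue_step.

(* n-dimensional Lebesgue measure on the Borel sets of R^n, obtained by iterating
   the product with the one-dimensional one. *)
Fixpoint lebesgue_rV n : {sigma_finite_measure set 'rV[R]_n -> \bar R} :=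
  match n with
  | 0 => \d_(0 : 'rV[R]_0)
  | m.+1 => lebesgue_step (lebesgue_rV m)
  end.

End lebesgue_rV.

Section euclidean_space.
Variables (R : realType) (n : nat).
Local Notation V := 'rV[R]_n.

Definition dotp (x y : V) : R := \sum_(i < n) x 0 i * y 0 i.

(* The library norm on ['rV_n] is the sup norm. *)
Definition enorm (x : V) : R := Num.sqrt (dotp x x).

Definition setdist (A B : set V) : \bar R :=
  ereal_inf [set (enorm (z.1 - z.2))%:E | z in A `*` B].

Definition boundary (A : set V) : set V := closure A `\` A°.

Definition domain (A : set V) : Prop := [/\ A !=set0, open A & connected A].

Definition compactly_inside (G Om : set V) : Prop :=
  [/\ G `<=` Om, (0 < setdist (boundary Om) G)%E & (0 < lebesgue_rV R n G)%E].

Definition convex_hull (m : nat) (v : 'I_m -> V) : set V :=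
  [set x | exists c : 'I_m -> R,
     [/\ forall k, 0 <= c k, \sum_k c k = 1 & x = \sum_k c k *: v k]].

Definition convex_polytope (P : set V) : Prop :=
  exists (m : nat) (v : 'I_m -> V), P = convex_hull v.

(* Faces in the sense of convex geometry; [set0] and [P] itself are faces of
   [P]. *)
Definition face (F P : set V) : Prop :=
  exists (a : V) (b : R),
    (forall x, P x -> dotp a x <= b) /\ F = P `&` [set x | dotp a x = b].

(* Near each boundary point and after a rotation sending [e] to the last
   coordinate axis, the set is the strict epigraph of a Lipschitz function
   [psi] of the other coordinates, encoded as a function on the whole space
   which does not vary along [e]. *)
Definition lipschitz_boundary (A : set V) : Prop :=
  forall x, boundary A x ->
  exists (e : V) (psi : V -> R) (L : R) (U : set V),
    [/\ enorm e = 1,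
        forall y t, psi (y + t *: e) = psi y,
        forall y z, `|psi y - psi z| <= L * enorm (y - z),
        nbhs x U &
        forall y, U y -> (A y <-> psi y < dotp e y)].

Definition polytopic (A : set V) : Prop :=
  exists S : set (set V),
    [/\ finite_set S, (forall P, S P -> convex_polytope P) &
        closure A = \bigcup_(P in S) P].

Definition polytopic_lipschitz_domain (A : set V) : Prop :=
  [/\ domain A, bounded_set A, polytopic A & lipschitz_boundary A].

End euclidean_space.

Section derivatives.
Variables (R : realType) (n : nat).
Local Notation V := 'rV[R]_n.
Local Notation mu := (lebesgue_rV R n).

Definition partial (i : 'I_n) (f : V -> R) : V -> R :=
  fun x => 'D_(delta_mx 0 i) f x.

Definition mi_order (a : 'I_n -> nat) : nat := (\sum_(i < n) a i)%N.

Definition unit_index (i : 'I_n) : 'I_n -> nat := fun j => nat_of_bool (j == i).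

Definition Dpartial (a : 'I_n -> nat) (f : V -> R) : V -> R :=
  foldr (fun i g => iter (a i) (partial i) g) f (enum 'I_n).

Definition smooth (f : V -> R) : Prop :=
  forall s : seq 'I_n, let g := foldr partial f s in
    continuous g /\ forall i x, derivable g x (delta_mx 0 i).

Definition test_function (G : set V) (phi : V -> R) : Prop :=
  smooth phi /\
  exists K, [/\ compact K, K `<=` G & forall x, ~ K x -> phi x = 0].

Definition locally_L1 (G : set V) (w : V -> R) : Prop :=
  measurable_fun G w /\
  forall K, compact K -> K `<=` G -> mu.-integrable K (EFin \o w).

Definition weak_derivative (G : set V) (a : 'I_n -> nat) (v w : V -> R) : Prop :=
  [/\ locally_L1 G v, locally_L1 G w &
      forall phi, test_function G phi ->
        \int[mu]_(x in G) (v x * Dpartial a phi x) =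
        (- 1) ^+ mi_order a * \int[mu]_(x in G) (w x * phi x)].

(* The weak derivative is unique up to a null set; one is picked, and it is
   meaningful only under [weakly_differentiable]. *)
Definition wD (G : set V) (a : 'I_n -> nat) (v : V -> R) : V -> R :=
  xget (cst 0) [set w | weak_derivative G a v w].

Definition weakly_differentiable (k : nat) (G : set V) (v : V -> R) : Prop :=
  forall a, (mi_order a <= k)%N -> exists w, weak_derivative G a v w.

End derivatives.

Section sobolev.
Variables (R : realType) (n : nat).
Local Notation V := 'rV[R]_n.
Local Notation mu := (lebesgue_rV R n).

Definition lp_sum (J : choiceType) (p : \bar R) (A : set J) (F : J -> \bar R)
    : \bar R :=
  match p with
  | q%:E => ((\sum_(k \in A) F k `^ q) `^ q^-1)%E
  | _ => ereal_sup [set F k | k in A]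
  end.

Definition Lp_norm (G : set V) (p : \bar R) (w : V -> R) : \bar R :=
  Lnorm mu p (fun x => (w x * \1_G x)%:E).

Definition multi_index (k : nat) (a : {ffun 'I_n -> 'I_k.+1}) : 'I_n -> nat :=
  fun i => a i.

(* Norm of W^{k,p}(G), equal to [+oo] outside of this space. *)
Definition sobolev_norm_nat (k : nat) (p : \bar R) (G : set V) (v : V -> R)
    : \bar R :=
  if `[< weakly_differentiable k G v >] then
    lp_sum p [set a : {ffun 'I_n -> 'I_k.+1} | (mi_order (multi_index a) <= k)%N]
      (fun a => Lp_norm G p (wD G (multi_index a) v))
  else +oo%E.

(* Sobolev-Slobodeckij (Gagliardo) seminorm of order 0 < theta < 1, i.e. the
   p-th root of the double integral of |w x - w y|^p / |x - y|^(n + theta p);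
   for p = +oo, the theta-Hoelder seminorm. *)
Definition slobodeckij (theta : R) (p : \bar R) (G : set V) (w : V -> R)
    : \bar R :=
  let n_over_p := if p is q%:E then n%:R / q else 0 in
  Lnorm (mu \x mu)%E p (fun z => (`|w z.1 - w z.2| /
    enorm (z.1 - z.2) `^ (n_over_p + theta) * \1_(G `*` G) z)%:E).

(* Norm of W^{s,p}(G) for real s >= 0. *)
Definition sobolev_norm (s : R) (p : \bar R) (G : set V) (v : V -> R)
    : \bar R :=
  let k := Num.truncn s in
  let theta := s - k%:R in
  if theta == 0 then sobolev_norm_nat k p G v
  else lp_sum p [set: bool] (fun b =>
    if b then sobolev_norm_nat k p G v
    else lp_sum p [set a : {ffun 'I_n -> 'I_k.+1} | mi_order (multi_index a) = k]
           (fun a => slobodeckij theta p G (wD G (multi_index a) v))).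

Definition in_sobolev (s : R) (p : \bar R) (G : set V) (v : V -> R) : Prop :=
  (sobolev_norm s p G v < +oo)%E.

Definition in_H10 (Om : set V) (v : V -> R) : Prop :=
  in_sobolev 1 2%:E Om v /\
  forall e : R, 0 < e -> exists2 phi, test_function Om phi &
    (sobolev_norm 1 2%:E Om (v \- phi)%R < e%:E)%E.

Definition in_L2 (Om : set V) (f : V -> R) : Prop :=
  measurable_fun Om f /\ (Lp_norm Om 2%:E f < +oo)%E.

Definition L2_inner (Om : set V) (f v : V -> R) : R :=
  \int[mu]_(x in Om) (f x * v x).

(* -Delta u = f in Om, u = 0 on the boundary, in the weak sense *)
Definition poisson_solution (Om : set V) (f u : V -> R) : Prop :=
  in_H10 Om u /\
  forall v, in_H10 Om v ->
    \int[mu]_(x in Om)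
      (\sum_(i < n) wD Om (unit_index i) u x * wD Om (unit_index i) v x)
    = L2_inner Om f v.

End sobolev.

Section finite_elements.
Variables (R : realType) (n : nat).
Local Notation V := 'rV[R]_n.
Local Notation mu := (lebesgue_rV R n).

(* Elements are closed convex polytopes with nonempty interior. *)
Definition face_to_face_partition (Om : set V) (T : set (set V)) : Prop :=
  [/\ finite_set T,
      forall K, T K -> convex_polytope K /\ K° !=set0,
      closure Om = \bigcup_(K in T) K &
      forall K K', T K -> T K' -> K <> K' ->
        [/\ K° `&` K'° = set0, face (K `&` K') K & face (K `&` K') K']].

Definition diam (K : set V) : R :=
  sup [set enorm (z.1 - z.2) | z in K `*` K].

Definition inscribed_diam (K : set V) : R :=
  sup [set 2 * rho | rho in
    [set rho : R | 0 <= rho /\ exists c, [set x | enorm (x - c) <= rho] `<=` K]].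

Definition mesh_size (T : set (set V)) : R := sup (diam @` T).

Definition regular_family (I : Type) (T : I -> set (set V)) : Prop :=
  exists2 sigma : R, 0 < sigma &
    forall i K, T i K -> diam K / inscribed_diam K < sigma.

Definition quasi_uniform (I : Type) (T : I -> set (set V)) : Prop :=
  regular_family T /\
  exists2 beta : R, 0 < beta &
    forall i K, T i K -> mesh_size (T i) / diam K <= beta.

(* Elements are closed and functions on the mesh are only prescribed inside
   them: the skeleton is a null set on which values are immaterial.  The degree
   is less than [r] in each variable, which covers both the polynomials of total
   degree less than [r] (simplices) and the tensor product ones (rectangles,
   bricks). *)
Definition piecewise_polynomial (r : nat) (T : set (set V)) (v : V -> R) : Prop :=
  measurable_fun [set: V] v /\
  forall K, T K -> exists c : {ffun 'I_n -> 'I_r} -> R,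
    forall x, K° x -> v x = \sum_a c a * \prod_(i < n) x 0 i ^+ a i.

Definition fe_space (r : nat) (T : set (set V)) (Vh : set (V -> R)) : Prop :=
  [/\ Vh (cst 0),
      (forall (a : R) v w, Vh v -> Vh w -> Vh (fun x => a * v x + w x)) &
      forall v, Vh v -> piecewise_polynomial r T v].

Definition energy_form (T : set (set V)) (v w : V -> R) : R :=
  \sum_(K \in T) \int[mu]_(x in K°) (\sum_(i < n) partial i v x * partial i w x).

Definition fe_solution (Om : set V) (T : set (set V)) (Vh : set (V -> R))
    (f uh : V -> R) : Prop :=
  Vh uh /\ forall vh, Vh vh -> energy_form T uh vh = L2_inner Om f vh.

Definition piecewise_norm (j : nat) (p : \bar R) (T : set (set V)) (v : V -> R)
    : \bar R :=
  lp_sum p T (fun K => sobolev_norm_nat j p K° v).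

Definition error_estimate (Om : set V) (u : V -> R) (I : Type)
    (T : I -> set (set V)) (uh : I -> V -> R) (p : \bar R) (l : nat) (s : R)
    : Prop :=
  exists2 C : R, 0 < C & forall i,
    (piecewise_norm l p (T i) (u \- uh i)%R
     <= (C * mesh_size (T i) `^ (s - l%:R))%:E * sobolev_norm s p Om u)%E.

(* The estimate of order [r - l] holds and the error is not bounded by any
   quantity of higher order than [h^(r - l)] as [h -> 0]. *)
Definition optimal_error_estimate (Om : set V) (u : V -> R) (I : Type)
    (T : I -> set (set V)) (uh : I -> V -> R) (p : \bar R) (l : nat) (r : R)
    : Prop :=
  error_estimate Om u T uh p l r /\
  forall omega : R -> R,
    omega t / t `^ (r - l%:R) @[t --> 0^'+] --> (0 : R) ->
    ~ (forall i, (piecewise_norm l p (T i) (u \- uh i)%R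
                  <= (omega (mesh_size (T i)))%:E)%E).

End finite_elements.

(* Main.v *)
Require Import Defs.
From HB Require Import structures.
From mathcomp Require Import all_boot all_order all_algebra.
From mathcomp Require Import all_classical all_reals all_analysis.
From mathcomp Require Import measurable_realfun ess_sup_inf ring lra.

Set Implicit Arguments.
Unset Strict Implicit.
Unset Printing Implicit Defensive.

Import Order.TTheory GRing.Theory Num.Theory.
Import numFieldNormedType.Exports.

Local Open Scope classical_set_scope.
Local Open Scope ring_scope.

(** Since D^gamma annihilates the discrete functions on every element, the error
    u - u_h has there the mesh-independent derivative w = D^gamma u.  Split
    gamma = alpha + beta with |alpha| = j and test against a bump phi of width
    rho supported inside an element K:
      | int w phi | = | int_K D^alpha (u - u_h) D^beta phi |
                   <= C rho^-(r - j) int_K |D^alpha (u - u_h)|.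
    Some cube Q inside G has w close in the mean to a constant a <> 0.  Cut Q
    into cells of side s, with s comparable to h.  If K is the element
    containing the centre x of a cell, shrinking K towards x by a factor
    comparable to s / h yields a cube of size comparable to s inside both K and
    the cell, by convexity and regularity.  Adding up over the cells the
    estimates for bumps carried by these cubes bounds |a| |Q| by h^-(r - j)
    times the norm of order j of the error.  The cells may be smaller than the
    elements, so that the constant is the same for coarse and for fine meshes. *)

(** * A smooth bump function *)

(** Since [w] may oscillate in sign, its integrals against bumps could cancel; hence the comparison
    with a constant [a], made in the mean because [w] need not be continuous. The bumps capture only
    a fixed fraction (e^-2 theta)^n of the volume of the cells, and the deviation of [w] from [a]
    must stay below that fraction. This fixes the order of the choices: theta depends on the family
    of meshes only, Q is found afterwards with half that fraction as tolerance, and the mesh comes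
    last. Placing each bump inside a single element means that only one polynomial is ever
    integrated by parts, so that neither jumps between elements nor the conformity of the discrete
    space enter. Distinct cells may fall into the same element; disjointness of the cells, not of
    the elements, is what allows the local estimates to be summed. The bump is a tensor product of
    rescaled copies of exp(-1/(1 - x^2)), which reduces every integration by parts to one variable.
    The passage from the norm of exponent p to an integral over Q uses a scalar inequality that
    treats all finite p alike. *)

Section bump.
Variable R : realType.
Implicit Types (N : nat) (P : {poly R}) (x : R).

(** Every derivative of exp(-1/(1 - x^2)), extended by zero, is a polynomial times a power of 1/(1 -
    x^2) times the function itself. The family indexed by [N] and [P] is closed under
    differentiation, so smoothness becomes an induction. *)
Definition bump_term N P x : R :=
  if `|x| < 1 then P.[x] * ((1 - x ^+ 2)^-1 ^+ N * expR (- (1 - x ^+ 2)^-1))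
  else 0.

(* For v = 1 - x^2, the derivative of P v^-N exp(-1/v) is
   (P' v^2 + 2 N x P v - 2 x P) v^-(N+2) exp(-1/v). *)
Definition bump_deriv N P : {poly R} :=
  P^`() * (1 - 'X ^+ 2) ^+ 2 + (2 * N%:R) *: ('X * P * (1 - 'X ^+ 2))
    - 2 *: ('X * P).

(** The bound forces f a = 0 and makes the difference quotients at a at most C |h|. It serves at the
    two ends of the support of the bump, where no single formula holds on both sides. *)
Lemma is_derive_quadratic (f : R -> R) (a C : R) :
  (forall x, `|f x| <= C * (x - a) ^+ 2) -> is_derive a 1 f 0.
Proof.
move=> fC; have C0 : 0 <= C.
  by have := le_trans (normr_ge0 _) (fC (a + 1)); rewrite addrC addKr expr1n mulr1.
have fa : f a = 0.
  by apply/eqP; rewrite -normr_le0; have := fC a; rewrite subrr expr0n/= mulr0.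
have L : h^-1 *: ((f \o shift a) (h *: 1) - f a) @[h --> 0^'] --> (0 : R).
  apply/cvgrPdist_le => e e0; near=> h.
  have h0 : h != 0 by near: h; exact: nbhs_dnbhs_neq.
  rewrite sub0r normrN fa subr0 /= scaler1 normrZ normfV ler_pdivrMl ?normr_gt0//.
  apply: (le_trans (fC _)); rewrite addrK -real_normK ?num_real//.
  rewrite expr2 mulrCA ler_pM2l ?normr_gt0//.
  have : `|h| <= e / (C + 1).
    near: h; apply: dnbhs0_le; first by rewrite divr_gt0// ltr_wpDl.
  rewrite ler_pdivlMr ?ltr_wpDl// mulrDr mulr1 => He.
  rewrite mulrC; apply: le_trans He; by rewrite lerDl.
by split; [apply/cvg_ex; exists 0 | exact/cvg_lim].
Unshelve. all: by end_near. Qed.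

(** With v = 1 - x^2, the exponential is O(v^(N+2)): it absorbs v^-N and leaves v^2, and v contains
    the factor x - a for both ends a = 1 and a = -1. *)
Lemma bump_term_quadratic N P : exists C : R, forall a x, `|a| = 1 ->
  `|bump_term N P x| <= C * (x - a) ^+ 2.
Proof.
have [B PB] : exists B : R, forall x, `|x| < 1 -> `|P.[x]| <= B.
  exists (\sum_(i < size P) `|P`_i|) => x x1.
  rewrite horner_coef (le_trans (ler_norm_sum _ _ _))// ler_sum// => i _.
  by rewrite normrM normrX ler_piMr// exprn_ile1// ltW.
exists (B * (N.+2%:R ^+ N.+2 * 4)) => a x a1; rewrite /bump_term.
case: ifPn => x1; last first.
  rewrite normr0 mulr_ge0 ?sqr_ge0// mulr_ge0//.
  by apply: le_trans (PB 0 _); rewrite ?normr0.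
have v0 : 0 < 1 - x ^+ 2.
  by rewrite subr_gt0 -real_normK ?num_real// expr_lt1.
rewrite normrM -mulrA ler_pM//; first exact: PB.
rewrite ger0_norm ?mulr_ge0 ?exprn_ge0 ?invr_ge0 ?expR_ge0 ?(ltW v0)//.
set v := 1 - x ^+ 2 in v0 *.
(* Raise 1 + y <= exp y to the power N + 2 at y = 1/((N + 2) v), and invert. *)
have E1 : expR (- v^-1) <= N.+2%:R ^+ N.+2 * v ^+ N.+2.
  pose y := (N.+2%:R * v)^-1.
  have y0 : 0 < y by rewrite invr_gt0 mulr_gt0.
  have -> : v^-1 = N.+2%:R * y by rewrite /y invfM mulrA divff// mul1r.
  rewrite expRN -exprMn expRM_natl -[N.+2%:R * v]invrK -/y exprVn.
  rewrite lef_pV2 ?posrE ?exprn_gt0 ?expR_gt0// lerXn2r ?nnegrE ?expR_ge0 ?(ltW y0)//.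
  by apply: le_trans (expR_ge1Dx _); rewrite lerDr.
apply: (@le_trans _ _ (v^-1 ^+ N * (N.+2%:R ^+ N.+2 * v ^+ N.+2))).
  by rewrite ler_pM2l ?exprn_gt0 ?invr_gt0.
rewrite mulrCA -mulrA ler_wpM2l ?exprn_ge0//.
rewrite (_ : v^-1 ^+ N * v ^+ N.+2 = v ^+ 2); last first.
  by rewrite -(addn2 N) exprD mulrA -exprMn mulVf ?gt_eqF// expr1n mul1r.
have a2 : a ^+ 2 = 1 by rewrite -real_normK ?num_real// a1 expr1n.
have -> : 4 * (x - a) ^+ 2 = (2 * (x - a)) ^+ 2 by ring.
have vE : v = - (x - a) * (x + a) by rewrite /v -a2; ring.
rewrite -(real_normK (num_real v)) -[leRHS]real_normK ?num_real//.
have xa : `|x + a| <= 2 by rewrite (le_trans (ler_normD _ _))// a1; lra.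
rewrite lerXn2r ?nnegrE// vE !normrM normrN mulrC ler_wpM2r//.
by rewrite (ger0_norm (ler0n _ 2)).
Qed.

Lemma is_derive_bump_term N P x :
  is_derive x 1 (bump_term N P) (bump_term N.+2 (bump_deriv N P) x).
Proof.
have [x1|x1|x1] := ltgtP `|x| 1.
- rewrite {2}/bump_term x1; pose g y := P.[y] *
    ((1 - y ^+ 2)^-1 ^+ N * expR (- (1 - y ^+ 2)^-1)).
  apply: (@near_eq_is_derive _ _ _ g).
    near=> y; rewrite /bump_term; suff -> : `|y| < 1 by [].
    by near: y; apply: (cvgr_norm_lt x) => //; exact: cvg_id.
  rewrite {}/g; have v0 : 1 - x ^+ 2 != 0.
    by rewrite gt_eqF// subr_gt0 -real_normK ?num_real// expr_lt1.
have d1 : is_derive x 1 (fun x : R => (1 - x ^+ 2)) (- (2 * x)).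
  apply: is_derive_eq; rewrite /GRing.scale /=. ring.
have d2 : is_derive x 1 (fun x : R => (1 - x ^+ 2)^-1) (2 * x * (1 - x ^+ 2)^-1 ^+ 2).
  apply: (is_derive_eq (@is_deriveV _ (fun x => 1 - x ^+ 2) x _ _ v0 d1)).
  by rewrite /GRing.scale/= -exprVn; ring.
have d3 : is_derive x 1 (fun x : R => expR (- (1 - x ^+ 2)^-1))
    (- (2 * x * (1 - x ^+ 2)^-1 ^+ 2) * expR (- (1 - x ^+ 2)^-1)).
  rewrite mulrC; exact: (@is_derive1_comp _ expR (fun x => - (1 - x ^+ 2)^-1)).
pose i := (1 - x ^+ 2)^-1; pose E := expR (- i).
have d4 : is_derive x 1 (fun y : R => (1 - y ^+ 2)^-1 ^+ N)
    (N%:R * i ^+ N.-1 * (2 * x * i ^+ 2)).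
  have := is_deriveX N d2; by rewrite exprfctE.
apply: (is_derive_eq (is_deriveM (is_derive_poly P x) (is_deriveM d4 d3))).
rewrite -[N.+2]addn2 exprD /bump_deriv /GRing.scale /= !hornerE/= -/i -/E.
have vi : (1 - x ^+ 2) * i = 1 by rewrite divff.
(* The truncated predecessor is harmless at N = 0, where the factor [N%:R] vanishes. *)
have iN : i ^+ N.-1 * i * N%:R = i ^+ N * N%:R.
  by case: N {d4} => [|M]; rewrite ?mulr0// -exprSr.
set p := P.[x]; set p' := P^`().[x]; set v := 1 - x ^+ 2 in vi *.
rewrite mulrfctE -/E -/v -/i.
transitivity (E * (p * (2 * x * i * (i ^+ N.-1 * i * N%:R)
    - 2 * x * i * i * i ^+ N) + p' * i ^+ N)).
  by ring.
(* Inserting factors v i = 1 brings every term to the common power i^(N+2), after which the identity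
   is polynomial. *)
rewrite iN; transitivity (E * (p * (2 * x * i * (i ^+ N * N%:R) * (v * i)
    - 2 * x * i * i * i ^+ N) + p' * (v * i) ^+ 2 * i ^+ N)).
  by rewrite vi; ring.
ring.
- rewrite {2}/bump_term ltNge (ltW x1)/=.
  apply: (@near_eq_is_derive _ _ _ (cst 0)).
  near=> y; rewrite /bump_term ltNge ltW//=.
  by near: y; apply: (cvgr_norm_gt x) => //; exact: cvg_id.
- have [C fC] := bump_term_quadratic N P.
  rewrite {2}/bump_term x1 ltxx.
  by apply: (@is_derive_quadratic _ _ C) => y; exact: fC.
Unshelve. all: by end_near. Qed.

(** Each differentiation raises the exponent of 1/(1 - x^2) by two, so the numerator of order [k]
    goes with the exponent [k.*2]. *)
Fixpoint bump_poly k : {poly R} :=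
  if k is l.+1 then bump_deriv (l.*2) (bump_poly l) else 1.

Definition bumpf k x : R := bump_term k.*2 (bump_poly k) x.

Lemma is_derive_bump k x : is_derive x 1 (bumpf k) (bumpf k.+1 x).
Proof. exact: is_derive_bump_term. Qed.

Lemma bump_out k x : 1 <= `|x| -> bumpf k x = 0.
Proof. by rewrite /bumpf /bump_term ltNge => ->. Qed.

Lemma bump_bounded k : exists2 M : R, 0 < M & forall x, `|bumpf k x| <= M.
Proof.
have [C CP] := bump_term_quadratic k.*2 (bump_poly k).
have C0 : 0 <= C.
  have := le_trans (normr_ge0 _) (CP 1 0 (normr1 _)).
  by rewrite sub0r sqrrN expr1n mulr1.
exists (C * 4 + 1); first by rewrite ltr_wpDl// mulr_ge0.
move=> x; have [x1|x1] := ltP `|x| 1; last first.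
  by rewrite bump_out// normr0 addr_ge0// mulr_ge0.
apply: (le_trans (CP 1 x (normr1 _))); rewrite ler_wpDr// ler_wpM2l//.
rewrite -real_normK ?num_real// (_ : 4 = 2 ^+ 2); last by ring.
rewrite lerXn2r ?nnegrE// (le_trans (ler_normB _ _))// normr1.
by rewrite -[2]/(1 + 1) lerD2r ltW.
Qed.

Lemma bump_ge0 x : 0 <= bumpf 0 x.
Proof.
rewrite /bumpf /bump_term; case: ifP => // _.
by rewrite expr0 hornerC !mul1r expR_ge0.
Qed.

Lemma bump_le1 x : bumpf 0 x <= 1.
Proof.
rewrite /bumpf /bump_term; case: ifPn => // x1.
rewrite expr0 hornerC !mul1r -[leRHS]expR0 ler_expR oppr_le0 invr_ge0 subr_ge0.
by rewrite -real_normK ?num_real// exprn_ile1// ltW.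
Qed.

Lemma bump_gt x : `|x| <= 2^-1 -> expR (- 2) <= bumpf 0 x.
Proof.
move=> x2; rewrite /bumpf /bump_term.
have -> : `|x| < 1 by apply: (le_lt_trans x2); lra.
rewrite expr0 hornerC !mul1r ler_expR lerN2 -[leRHS]invrK.
have : x ^+ 2 <= 4^-1.
  rewrite -real_normK ?num_real// (_ : 4^-1 = 2^-1 ^+ 2); last by field.
  by rewrite lerXn2r ?nnegrE.
by move=> ?; rewrite lef_pV2 ?posrE; lra.
Qed.

End bump.

(** * Partial derivatives of products of one-variable functions *)

Lemma is_derive_line (R : numFieldType) (V W : normedModType R) (f : V -> W)
    (x v : V) (l : W) :
  is_derive (0 : R) 1 (fun h : R => f (h *: v + x)) l -> is_derive x v f l.
Proof.
have E : (fun h : R => h^-1 *: (f (h *: v + x) - f x)) =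
    (fun h : R => h^-1 *: (f ((h * 1 + 0) *: v + x) - f (0 *: v + x))).
  by apply/funext => h; rewrite addr0 scale0r add0r mulr1.
move=> [D L]; apply: (@DeriveDef R V W x v f l); first exact/derivable1P.
rewrite -L; exact: (congr1 (fun g : R -> W => lim (g @ 0^')) E).
Qed.

Section product_functions.
Variables (R : realType) (n : nat).
Local Notation V := 'rV[R]_n.
Implicit Types (d : 'I_n -> nat -> R -> R) (m a : 'I_n -> nat).

(* [d i k] stands for the k-th derivative of the i-th factor. *)
Definition prodfun d m (x : V) : R := \prod_i d i (m i) (x 0 i).

Definition derivative_seq (g : nat -> R -> R) : Prop :=
  forall k (t : R), is_derive t 1 (g k) (g k.+1 t).

Lemma continuous_derivative_seq g k : derivative_seq g -> continuous (g k).
Proof.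
move=> dg t; apply/differentiable_continuous/derivable1_diffP.
by have [] := dg k t.
Qed.

Lemma continuous_prodfun d m : (forall i, derivative_seq (d i)) ->
  continuous (prodfun d m).
Proof.
move=> Hd; rewrite /prodfun; apply: continuous_big => [|i _ x].
  exact: mul_continuous.
apply: continuous_comp; first exact: coord_continuous.
exact: continuous_derivative_seq.
Qed.

Lemma is_derive_prodfun d m i x : (forall i, derivative_seq (d i)) ->
  is_derive x (delta_mx 0 i) (prodfun d m)
    (prodfun d (fun j => m j + (j == i))%N x).
Proof.
move=> Hd; apply: is_derive_line.
pose c := \prod_(j | j != i) d j (m j) (x 0 j).
have -> : (fun h : R => prodfun d m (h *: delta_mx 0 i + x)) =
    c \*: (d i (m i) \o (fun h => h + x 0 i)).
  apply/funext => h; rewrite /prodfun (bigD1 i)//= !mxE !eqxx mulr1 mulrC.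
  congr (_ * _); apply: eq_bigr => j ji.
  by rewrite !mxE (negPf ji) andbF mulr0 add0r.
have D1 : is_derive (0 : R) 1 (fun h : R => h + x 0 i) 1.
  by apply: is_derive_eq; rewrite addr0.
have D2 : is_derive (0 : R) 1 (d i (m i) \o (fun h => h + x 0 i))
    (d i (m i).+1 (x 0 i) * 1).
  by apply: is_derive1_comp; rewrite add0r; exact: Hd.
apply: is_derive_eq; rewrite /prodfun (bigD1 i)//= eqxx addn1 mulr1 mulrC.
congr (_ * _); apply: eq_bigr => j ji.
by rewrite (negPf ji) addn0.
Qed.

Lemma partial_prodfun d m i : (forall i, derivative_seq (d i)) ->
  partial i (prodfun d m) = prodfun d (fun j => m j + (j == i))%N.
Proof.
by move=> Hd; apply/funext => x; have [_] := is_derive_prodfun m i x Hd.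
Qed.

Lemma foldr_partial_family (F : ('I_n -> nat) -> V -> R) m s :
  (forall m i, partial i (F m) = F (fun j => m j + (j == i))%N) ->
  foldr (@partial R n) (F m) s = F (fun j => m j + count_mem j s)%N.
Proof.
move=> HF; elim: s => [|i s ih] /=.
  by congr F; apply/funext => j; rewrite addn0.
rewrite ih HF; congr F; apply/funext => j.
by rewrite -addnA [(_ + (_ == _))%N]addnC eq_sym.
Qed.

(** Stated for an abstract family indexed by multi-indices, so that it applies both to single
    products (the cutoffs) and to sums of products (the polynomials on an element). *)
Lemma Dpartial_family (F : ('I_n -> nat) -> V -> R) m a :
  (forall m i, partial i (F m) = F (fun j => m j + (j == i))%N) ->
  Dpartial a (F m) = F (fun j => m j + a j)%N.
Proof.
move=> HF; have itE i k m' : iter k (partial i) (F m') =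
    F (fun j => m' j + (j == i) * k)%N.
  elim: k => [|k ih] /=.
    by congr F; apply/funext => j; rewrite muln0 addn0.
  rewrite ih HF; congr F; apply/funext => j.
  by rewrite mulnS -addnA [((_ == _) + _)%N]addnC.
have -> : Dpartial a (F m) =
    F (fun j => m j + count_mem j (enum 'I_n) * a j)%N.
  rewrite /Dpartial; elim: (enum 'I_n) => [|i s ih] /=.
    by congr F; apply/funext => j; rewrite mul0n addn0.
  rewrite ih itE; congr F; apply/funext => j.
  rewrite -addnA mulnDl [((i == j) * _ + _)%N]addnC eq_sym.
  by have [->|] := eqVneq i j.
congr F; apply/funext => j.
by rewrite count_uniq_mem ?enum_uniq// mem_enum mul1n.
Qed.

Lemma Dpartial_prodfun d m a : (forall i, derivative_seq (d i)) ->
  Dpartial a (prodfun d m) = prodfun d (fun j => m j + a j)%N.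
Proof. by move=> Hd; apply: Dpartial_family => m' i; exact: partial_prodfun. Qed.

(** The form taken by a polynomial on an element: [A] indexes its monomials. Keeping each term a
    product lets its integrals factor by Fubini. *)
Definition prodfun_sum (A : finType) (C : A -> R) (D : A -> 'I_n -> nat -> R -> R)
    m (x : V) : R := \sum_(l : A) C l * prodfun (D l) m x.

Lemma partial_prodfun_sum (A : finType) (C : A -> R) D m i :
  (forall l i, derivative_seq (D l i)) ->
  partial i (prodfun_sum C D m) = prodfun_sum C D (fun j => m j + (j == i))%N.
Proof.
move=> HD; apply/funext => x; rewrite /prodfun_sum.
suff [_] : is_derive x (delta_mx 0 i) (fun x => \sum_(l : A) C l * prodfun (D l) m x)
  (\sum_(l : A) C l * prodfun (D l) (fun j => m j + (j == i))%N x) by [].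
elim: (index_enum A) => [|l s ih].
  by under eq_fun do rewrite big_nil; rewrite big_nil; exact: is_derive_cst.
under eq_fun do rewrite big_cons; rewrite big_cons.
apply: (@is_deriveD _ _ _ (fun x => C l * prodfun (D l) m x)) => //.
exact: (@is_deriveZ _ _ _ (prodfun (D l) m) (C l) _ _ _
  (is_derive_prodfun m i x (HD l))).
Qed.

Lemma smooth_prodfun d m : (forall i, derivative_seq (d i)) ->
  smooth (prodfun d m).
Proof.
move=> Hd s; rewrite (foldr_partial_family _ _ (fun m i => partial_prodfun m i Hd))/=.
split=> [|i x]; first exact: continuous_prodfun.
by have [] := is_derive_prodfun (fun j => m j + count_mem j s)%N i x Hd.
Qed.

End product_functions.

(** * Lebesgue measure on R^n, cubes and grids *)

Section product_integral.
Variable R : realType.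
Local Notation mu1 := (@lebesgue_measure R).
Local Notation mu n := (lebesgue_rV R n).

Lemma integral_prodmeas d1 d2 (T1 : measurableType d1) (T2 : measurableType d2)
    (m1 : {sigma_finite_measure set T1 -> \bar R})
    (m2 : {sigma_finite_measure set T2 -> \bar R}) (g : T1 -> R) (h : T2 -> R) :
  m1.-integrable setT (EFin \o g) -> m2.-integrable setT (EFin \o h) ->
  (m1 \x m2)%E.-integrable setT (fun z => (g z.1 * h z.2)%:E) /\
  (\int[m1 \x m2]_z (g z.1 * h z.2)%:E = \int[m1]_x (g x)%:E * \int[m2]_y (h y)%:E)%E.
Proof.
move=> ig ih.
have mg : measurable_fun setT g by apply/measurable_EFinP; exact: measurable_int ig.
have mh : measurable_fun setT h by apply/measurable_EFinP; exact: measurable_int ih.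
have mgh : measurable_fun setT (fun z : T1 * T2 => (g z.1 * h z.2)%:E).
  apply/measurable_EFinP; apply: measurable_funM.
    exact: (measurableT_comp mg measurable_fst).
  exact: (measurableT_comp mh measurable_snd).
have igh : (m1 \x m2)%E.-integrable setT (fun z => (g z.1 * h z.2)%:E).
  apply/(integrable12ltyP _ _ mgh) => /=.
  under eq_integral => x _.
    under eq_integral => y _ do rewrite normrM EFinM.
    rewrite ge0_integralZl//; last exact/measurable_EFinP/measurableT_comp.
    over.
  rewrite ge0_integralZr//.
  - apply: lte_mul_pinfty.
    + exact: integral_ge0.
    + have /integrableP[_ go] := ig; rewrite ge0_fin_numE//; exact: integral_ge0.
    + by have /integrableP[] := ih.
  - exact/measurable_EFinP/measurableT_comp.
  - exact: integral_ge0.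
split=> //; rewrite -integral12_prod_meas1// /fubini_F/=.
under eq_integral => x _.
  under eq_integral => y _ do rewrite EFinM.
  rewrite integralZl//.
  over.
have /fineK <- := integrable_fin_num measurableT ih.
by rewrite integralZr.
Qed.

(** Induction along the construction of [lebesgue_rV]: the measure in dimension n + 1 is the image
    of a product measure, so Fubini splits off the first coordinate. In dimension 0 the measure is a
    Dirac mass and both sides are the empty product. *)
Lemma integral_prod_rV n (g : 'I_n -> R -> R) :
  (forall i, mu1.-integrable setT (EFin \o g i)) ->
  (mu n).-integrable setT (fun x => (\prod_i g i (x 0 i))%:E) /\
  (\int[mu n]_x (\prod_i g i (x 0 i))%:E = \prod_i \int[mu1]_t (g i t)%:E)%E.
Proof.
elim: n g => [|n IH] g ig.
  have mf : measurable_fun setT (fun x : 'rV[R]_0 => (\prod_i g i (x 0 i))%:E).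
    by apply/measurable_EFinP; under eq_fun do rewrite big_ord0; exact: measurable_cst.
  split; last by rewrite integral_dirac// diracT mul1e !big_ord0.
  apply/integrableP; split => //; rewrite integral_dirac// ?diracT ?mul1e ?ltry//.
  exact: measurableT_comp.
pose h (x : 'rV[R]_n) := \prod_i g (lift ord0 i) (x 0 i).
have [ih hE] := IH (fun i => g (lift ord0 i)) (fun i => ig _).
have [igh ghE] := @integral_prodmeas _ _ _ _ mu1 (mu n) _ h (ig ord0) ih.
pose F (x : 'rV[R]_n.+1) := (\prod_i g i (x 0 i))%:E.
have FE : F \o @rV_cons R n = fun z => (g ord0 z.1 * h z.2)%:E.
  apply/funext => z; rewrite /F /= big_ord_recl mxE unlift_none; congr (_ * _)%:E.
  by apply: eq_bigr => i _; rewrite mxE liftK.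
have mF : measurable_fun setT F.
  apply/measurable_EFinP; apply: measurable_prod => i _.
  apply: (@measurableT_comp _ _ _ _ _ _ (g i)); last exact: measurable_coor.
  by apply/measurable_EFinP; exact: measurable_int (ig i).
(* [lebesgue_measure] lives on a copy of [R] with another measure display. *)
have mcons : @measurable_fun _ _ (measurableTypeR R * 'rV[R]_n)%type _ setT
    (@rV_cons R n).
  exact: (@measurable_rV_cons R n).
split.
  have iF : (mu1 \x mu n)%E.-integrable (@rV_cons R n @^-1` setT) (F \o @rV_cons R n).
    by rewrite preimage_setT FE.
  exact: (integrable_pushforward mcons mF iF measurableT).
transitivity (\int[(mu1 \x mu n)%E]_z (F \o @rV_cons R n) z)%E.
  rewrite -[LHS]/(\int[pushforward (mu1 \x mu n)%E (@rV_cons R n)]_x F x)%E.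
  rewrite (integral_pushforward mcons mF)// ?preimage_setT//.
  by rewrite FE.
by rewrite FE ghE hE big_ord_recl.
Qed.

End product_integral.

Section cubes.
Variables (R : realType) (n : nat).
Local Notation V := 'rV[R]_n.
Local Notation mu := (lebesgue_rV R n).
Local Notation mu1 := (@lebesgue_measure R).
Implicit Types (c : V) (s : R).

(** Half-open, with [c] its lowest corner and [s] its side, so that grid cells tile without overlap.
    [closed_cube] is instead given by centre and half-side; being compact, it can carry a test
    function. *)
Definition cube c s : set V :=
  [set x | forall i, c 0 i <= x 0 i < c 0 i + s].

Definition closed_cube c s : set V :=
  [set x | forall i, `|x 0 i - c 0 i| <= s].

Lemma measurable_box (A : 'I_n -> set R) : (forall i, measurable (A i)) ->
  measurable [set x : V | forall i, A i (x 0 i)].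
Proof.
move=> mA; have -> : [set x : V | forall i, A i (x 0 i)] =
    \bigcap_(i in [set: 'I_n]) (setT `&` (fun x : V => x 0 i) @^-1` A i).
  by apply/seteqP; split=> x /= H i => [_|]; [split=> //; exact: H|case: (H i)].
by apply: fin_bigcap_measurable => // i _; exact: measurable_coor.
Qed.

Lemma lebesgue_box (A : 'I_n -> set R) (l : 'I_n -> R) :
  (forall i, measurable (A i)) -> (forall i, mu1 (A i) = (l i)%:E) ->
  mu [set x : V | forall i, A i (x 0 i)] = (\prod_i l i)%:E.
Proof.
move=> mA lA; pose g i : R -> R := \1_(A i).
have gE i : (\int[mu1]_x (g i x)%:E = (l i)%:E)%E.
  by rewrite -lA -[A i in RHS]setIT; apply: integral_indic => //; exact: mA.
have ig i : mu1.-integrable setT (EFin \o g i).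
  apply/integrableP; split.
    by apply/measurable_EFinP; apply: measurable_indic; exact: mA.
  under eq_integral do rewrite /= ger0_norm//.
  by rewrite gE ltry.
have [_] := integral_prod_rV ig.
have -> : (fun x : V => (\prod_i g i (x 0 i))%:E) =
    (fun x => (\1_[set x : V | forall i, A i (x 0 i)] x)%:E).
  apply/funext => x; congr EFin; rewrite indicE; have [|] := boolP (_ \in _).
    by rewrite inE/= => H; rewrite big1// => i _; rewrite /g indicE mem_set.
  rewrite notin_setE/= => /existsNP[i NA]; rewrite (bigD1 i)//= /g indicE memNset//.
  by rewrite mul0r.
rewrite integral_indic//; last exact: measurable_box.
rewrite setIT => ->; rewrite -prodEFin.
by apply: eq_bigr => i _; rewrite gE.
Qed.

Lemma measurable_cube c s : measurable (cube c s).
Proof.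
apply: (@measurable_box (fun i => `[c 0 i, c 0 i + s[%classic)) => i.
exact: measurable_itv.
Qed.

Lemma closed_cubeE c s :
  closed_cube c s = [set x | forall i, `[c 0 i - s, c 0 i + s]%classic (x 0 i)].
Proof.
apply/seteqP; split=> x H i; move: (H i).
  by rewrite ler_distl /= in_itv.
by rewrite /= in_itv/= ler_distl.
Qed.

Lemma measurable_closed_cube c s : measurable (closed_cube c s).
Proof.
rewrite closed_cubeE.
apply: (@measurable_box (fun i => `[c 0 i - s, c 0 i + s]%classic)) => i.
exact: measurable_itv.
Qed.

Lemma compact_closed_cube c s : compact (closed_cube c s).
Proof.
rewrite closed_cubeE.
apply: (@rV_compact _ _ (fun i => `[c 0 i - s, c 0 i + s]%classic)) => i.
exact: segment_compact.
Qed.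

Lemma lebesgue_cube c s : 0 <= s -> mu (cube c s) = (s ^+ n)%:E.
Proof.
move=> s0; rewrite (@lebesgue_box (fun i => `[c 0 i, c 0 i + s[%classic) (fun=> s)).
- by rewrite prodr_const card_ord.
- by move=> i; exact: measurable_itv.
- move=> i; rewrite lebesgue_measure_itv/= lte_fin ltrDl.
  have [s1|s1] := ltP 0 s; first by rewrite -EFinB addrAC subrr add0r.
  by congr EFin; apply/eqP; rewrite eq_le s0.
Qed.

Lemma lebesgue_closed_cube c s : 0 <= s ->
  mu (closed_cube c s) = ((2 * s) ^+ n)%:E.
Proof.
move=> s0; rewrite closed_cubeE.
rewrite (@lebesgue_box (fun i => `[c 0 i - s, c 0 i + s]%classic) (fun=> 2 * s)).
- by rewrite prodr_const card_ord.
- by move=> i; exact: measurable_itv.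
- move=> i; rewrite lebesgue_measure_itv/= lte_fin.
  have [s1|s1] := ltP (c 0 i - s) (c 0 i + s).
    by rewrite -EFinB; congr EFin; ring.
  by congr EFin; lra.
Qed.

(** The closed cube is centred at the corner of the half-open one and has twice its side. This crude
    inclusion is enough to place a cube compactly inside an open set. *)
Lemma cube_closed_cube c s : cube c s `<=` closed_cube c s.
Proof.
move=> x H i; have /andP[h1 h2] := H i.
by rewrite ger0_norm ?subr_ge0// lerBlDl ltW.
Qed.

Definition grid_corner N (k : {ffun 'I_n -> int}) : V :=
  \row_i ((k i)%:~R / N.+1%:R).

(** Take all grid cubes of mesh 1/(N + 1) whose closed enlargement stays in [U], for all N at once.
    The cubes overlap, but there are countably many. As the sigma-algebra is generated by the
    coordinates, this is also what makes open sets measurable. *)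
Lemma open_bigcup_cube (U : set V) : open U -> exists F : nat -> set V,
  U = \bigcup_k F k /\ forall k, F k = set0 \/
    exists c s, [/\ 0 < s, F k = cube c s & closed_cube c s `<=` U].
Proof.
move=> oU.
pose F0 (z : nat * {ffun 'I_n -> int}) :=
  if `[< closed_cube (grid_corner z.1 z.2) z.1.+1%:R^-1 `<=` U >]
  then cube (grid_corner z.1 z.2) z.1.+1%:R^-1 else set0.
exists (fun k => if unpickle k is Some z then F0 z else set0); split; last first.
  move=> k; case: unpickle => [z|]; last by left.
  rewrite /F0; case: ifPn => [/asboolP zU|_]; last by left.
  by right; exists (grid_corner z.1 z.2), z.1.+1%:R^-1; split.
apply/seteqP; split=> x; last first.
  move=> [k _]; case: unpickle => [z|//].
  rewrite /F0; case: ifPn => [/asboolP zU|//] /cube_closed_cube; exact: zU.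
move=> Ux; have : nbhs x U by exact: open_nbhs_nbhs.
rewrite -nbhs_ballE => -[e /= e0 eU].
(* Two points of the closed cube of half-side 1/(N + 1) are within 2/(N + 1) in the sup norm, whence
   e / 2. *)
have [N Ne] : exists N, N.+1%:R^-1 < e / 2.
  have e2 : 0 < e / 2 by rewrite divr_gt0.
  exists (Num.truncn (e / 2)^-1); rewrite -[ltRHS]invrK ltf_pV2 ?posrE ?invr_gt0//.
  have i0 : 0 <= (e / 2)^-1 by rewrite invr_ge0 ltW.
  by have /andP[] := truncn_itv i0.
pose k : {ffun 'I_n -> int} := [ffun i => Num.floor (x 0 i * N.+1%:R)].
have xk : cube (grid_corner N k) N.+1%:R^-1 x.
  move=> i; rewrite mxE ffunE; have /andP[f1 f2] := floor_itv (x 0 i * N.+1%:R).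
  rewrite ler_pdivrMr// f1/= -[X in _ + X]div1r -mulrDl ltr_pdivlMr//.
  by move: f2; rewrite intrD1.
exists (pickle (N, k)) => //; rewrite pickleK /F0/=; case: asboolP => // -[].
move=> y yk; apply: eU; split=> // i j; rewrite (ord1 i); rewrite /ball/=.
apply: (@le_lt_trans _ _ (N.+1%:R^-1 + N.+1%:R^-1)); last by rewrite [ltRHS]splitr ltrD.
rewrite (le_trans (ler_distD (grid_corner N k 0 j) _ _))// lerD//.
  exact: (cube_closed_cube xk).
by rewrite distrC; exact: yk.
Qed.

Lemma measurable_open (U : set V) : open U -> measurable U.
Proof.
move=> /open_bigcup_cube[F [-> FE]]; apply: bigcup_measurable => k _.
case: (FE k) => [->//|[c [s [_ -> _]]]]; exact: measurable_cube.
Qed.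

Definition subcorner c s m (k : {ffun 'I_n -> 'I_m}) : V :=
  \row_i (c 0 i + s * (k i)%:R).

Lemma cube_tiling c s m : 0 < s -> (0 < m)%N ->
  cube c (s * m%:R) =
  \big[setU/set0]_(k : {ffun 'I_n -> 'I_m}) cube (subcorner c s k) s.
Proof.
move=> s0 m0; rewrite -bigcup_seq; apply/seteqP; split=> x.
  move=> xc; have m1 i : (Num.truncn ((x 0 i - c 0 i) / s)%R < m)%N.
    have /andP[h1 h2] := xc i.
    have x0 : 0 <= (x 0 i - c 0 i) / s by rewrite divr_ge0 ?subr_ge0// ltW.
    have /andP[t1 _] := truncn_itv x0.
    rewrite -(ltr_nat R) (le_lt_trans t1)// ltr_pdivrMr// mulrC ltrBlDl.
    by rewrite (lt_le_trans h2).
  exists [ffun i => Ordinal (m1 i)]; first by rewrite /= mem_index_enum.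
  move=> i; rewrite mxE ffunE/=; have /andP[h1 h2] := xc i.
  have x0 : 0 <= (x 0 i - c 0 i) / s by rewrite divr_ge0 ?subr_ge0// ltW.
  have /andP[t1 t2] := truncn_itv x0.
  move: t1 t2; rewrite ler_pdivlMr// ltr_pdivrMr// -natr1.
  by move=> t1 t2; apply/andP; split; lra.
move=> [k _ xk] i; move: (xk i); rewrite mxE => /andP[h1 h2]; apply/andP; split.
  by apply: le_trans h1; rewrite lerDl mulr_ge0// ltW.
apply: (lt_le_trans h2); rewrite -addrA lerD2l -[X in _ + X]mulr1 -mulrDr.
by rewrite ler_pM2l// natr1 ler_nat.
Qed.

Lemma cube_trivIset c s m : 0 < s ->
  trivIset setT (fun k : {ffun 'I_n -> 'I_m} => cube (subcorner c s k) s).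
Proof.
move=> s0; apply/trivIsetP => k l _ _ kl; apply/seteqP; split=> // x [xk xl].
move/eqP : kl; apply; apply/ffunP => i; apply/val_inj => /=.
have kE (j : {ffun 'I_n -> 'I_m}) : cube (subcorner c s j) s x ->
    j i = Num.truncn ((x 0 i - c 0 i) / s) :> nat.
  move=> /(_ i); rewrite mxE => /andP[h1 h2]; apply/esym/truncn_def.
  rewrite ler_pdivlMr// ltr_pdivrMr// -natr1.
  by apply/andP; split; lra.
by rewrite (kE k)// (kE l).
Qed.

Lemma ge0_integral_tiling c s m (f : V -> \bar R) : 0 < s -> (0 < m)%N ->
  measurable_fun (cube c (s * m%:R)) f ->
  (forall x, cube c (s * m%:R) x -> (0 <= f x)%E) ->
  (\int[mu]_(x in cube c (s * m%:R)) f x =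
   \sum_(k : {ffun 'I_n -> 'I_m}) \int[mu]_(x in cube (subcorner c s k) s) f x)%E.
Proof.
move=> s0 m0; rewrite cube_tiling// => mf f0.
rewrite ge0_integral_bigsetU//.
- by move=> k; exact: measurable_cube.
- exact: index_enum_uniq.
- by apply: (@sub_trivIset _ _ _ setT) => //; exact: cube_trivIset.
Qed.

End cubes.

(** * Approximation by constants on cubes *)

Definition symdiff (T : Type) (A B : set T) : set T := (A `\` B) `|` (B `\` A).

Section grid_approximation.
Variables (R : realType) (n : nat) (c : 'rV[R]_n) (q : R).
Hypothesis q0 : 0 < q.
Local Notation V := 'rV[R]_n.
Local Notation mu := (lebesgue_rV R n).
Local Notation Q := (cube c q).
Implicit Types (A B D : set V) (M : nat).

(* Unions of cells of the grid of mesh [q / M] based at [c]. *)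
Definition saturated M D := forall x y : V,
  (forall i (k : int), (k%:~R * q <= M%:R * (x 0 i - c 0 i)) =
                       (k%:~R * q <= M%:R * (y 0 i - c 0 i))) -> D x -> D y.

(** The sets with this property form a sigma-algebra containing the coordinate half-spaces, hence
    contain all measurable sets. Closeness is asked only inside Q, whose finite measure is what
    makes countable unions work. *)
Definition approximable A := measurable A /\
  forall e : R, 0 < e -> exists M D, [/\ (0 < M)%N, measurable D, saturated M D &
    (mu (Q `&` symdiff A D) < e%:E)%E].

Lemma measurable_symdiff A B : measurable A -> measurable B ->
  measurable (symdiff A B).
Proof. by move=> mA mB; apply: measurableU; exact: measurableD. Qed.

Lemma saturatedMl M N D : (0 < N)%N -> saturated M D -> saturated (N * M) D.
Proof.
move=> N0 sD x y xy; apply: sD => i k.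
have := xy i (N%:Z * k)%R; rewrite intrM natrM -!mulrA.
by rewrite !ler_pM2l// ?ltr0n//.
Qed.

Lemma saturatedMr M N D : (0 < N)%N -> saturated M D -> saturated (M * N) D.
Proof. by rewrite mulnC; exact: saturatedMl. Qed.

Lemma approximable0 : approximable set0.
Proof.
split=> // e e0; exists 1%N, set0; split => //.
by rewrite /symdiff !set0D setU0 setI0 measure0 lte_fin.
Qed.

Lemma approximableC A : approximable A -> approximable (~` A).
Proof.
move=> [mA HA]; split=> [|e e0]; first exact: measurableC.
have [M [D [M0 mD sD le]]] := HA e e0; exists M, (~` D); split=> //.
- exact: measurableC.
- move=> x y xy NDx Dy; apply: NDx; apply: sD Dy => i k; exact/esym/xy.
- rewrite (_ : symdiff (~` A) (~` D) = symdiff A D)//.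
  by rewrite /symdiff !setDE !setCK setUC [A `&` _]setIC [D `&` _]setIC.
Qed.

Lemma approximableU A B : approximable A -> approximable B -> approximable (A `|` B).
Proof.
move=> [mA HA] [mB HB]; split=> [|e e0]; first exact: measurableU.
have e2 : 0 < e / 2 by rewrite divr_gt0.
have [M [D [M0 mD sD le]]] := HA _ e2; have [N [E [N0 mE sE le']]] := HB _ e2.
exists (M * N)%N, (D `|` E); split.
- by rewrite muln_gt0 M0.
- exact: measurableU.
- move=> x y xy [Dx|Ex]; [left|right].
    exact: (saturatedMr N0 sD) Dx.
  exact: (saturatedMl M0 sE) Ex.
have mQ := measurable_cube c q.
apply: (@le_lt_trans _ _ (mu ((Q `&` symdiff A D) `|` (Q `&` symdiff B E)))).
  apply: le_measure; rewrite ?inE.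
  - by apply: measurableI => //; apply: measurable_symdiff; exact: measurableU.
  - by apply: measurableU; apply: measurableI => //; exact: measurable_symdiff.
  - move=> x [Qx [[[Ax|Bx] /not_orP[? ?]]|[[Dx|Ex] /not_orP[? ?]]]].
    + by left; split=> //; left.
    + by right; split=> //; left.
    + by left; split=> //; right.
    + by right; split=> //; right.
rewrite (le_lt_trans (measureU2 _ _ _))//.
- by apply: measurableI => //; exact: measurable_symdiff.
- by apply: measurableI => //; exact: measurable_symdiff.
by rewrite [e]splitr EFinD lteD.
Qed.

(** Inside Q the finite unions exhaust the countable one up to measure e / 2, by continuity from
    above; a finite union is then approximated up to the other e / 2. *)
Lemma approximable_bigcup (F : nat -> set V) : (forall k, approximable (F k)) ->
  approximable (\bigcup_k F k).
Proof.
move=> HF; have mF k : measurable (F k) by have [] := HF k.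
have mU : measurable (\bigcup_k F k) by exact: bigcup_measurable.
have mQ := measurable_cube c q.
split=> // e e0.
have e2 : 0 < e / 2 by rewrite divr_gt0.
pose U N := \big[setU/set0]_(k < N) F k.
have aU N : approximable (U N).
  rewrite /U; elim: N => [|N ih]; first by rewrite big_ord0; exact: approximable0.
  by rewrite big_ord_recr/=; exact: approximableU.
have mUN N : measurable (U N) by have [] := aU N.
pose W N := Q `&` (\bigcup_k F k `\` U N).
have [N Ne] : exists N, (mu (W N) < (e / 2)%:E)%E.
  have mW N : measurable (W N) by apply: measurableI => //; exact: measurableD.
  have W0 : \bigcap_N W N = set0.
    apply/seteqP; split=> // x WNx; have [_ [[k _ Fkx] _]] := WNx 0%N I.
    have [_ [_]] := WNx k.+1 I; apply; rewrite /U -bigcup_mkord.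
    by exists k => /=.
  have cv : mu \o W @ \oo --> (0 : \bar R)%E.
    rewrite -(@measure0 _ _ _ mu) -W0; apply: nonincreasing_cvg_mu.
    - apply: (@le_lt_trans _ _ (mu Q)); last by rewrite lebesgue_cube ?ltry// ltW.
      by apply: le_measure; rewrite ?inE//; exact: subIsetl.
    - exact: mW.
    - by rewrite W0.
    - move=> a b ab; apply/subsetPset => x [Qx [Fx NUx]]; split=> //; split=> //.
      move=> Uax; apply: NUx; move: Uax; rewrite /U -!bigcup_mkord => -[k /= ka Fk].
      by exists k => //=; exact: leq_trans ab.
  have e2' : (0 < (e / 2)%:E)%E by rewrite lte_fin.
  have [N _ NP] := cv _ (open_ereal_lt' e2').
  by exists N; apply: NP => /=.
have [_ /(_ _ e2)[M [D [M0 mD sD le]]]] := aU N.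
exists M, D; split=> //.
apply: (@le_lt_trans _ _ (mu (W N `|` (Q `&` symdiff (U N) D)))).
  apply: le_measure; rewrite ?inE.
  - by apply: measurableI => //; exact: measurable_symdiff.
  - apply: measurableU; first by apply: measurableI => //; exact: measurableD.
    by apply: measurableI => //; exact: measurable_symdiff.
  - move=> x [Qx [[Fx NDx]|[Dx NFx]]].
    + have [UNx|NUNx] := pselect (U N x); last by left.
      by right; split=> //; left.
    + right; split=> //; right; split=> // UNx; apply: NFx.
      by move: UNx; rewrite /U -bigcup_mkord => -[k _ Fk]; exists k.
rewrite (le_lt_trans (measureU2 _ _ _))//.
- by apply: measurableI => //; exact: measurableD.
- by apply: measurableI => //; exact: measurable_symdiff.
by rewrite [e]splitr EFinD lteD.
Qed.

(** The open half-space is the union over N of closed half-spaces bounded by grid hyperplanes of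
    mesh q/(N + 1); [k N] indexes the first such hyperplane strictly beyond [x]. *)
Lemma approximable_ray i (x : R) : approximable [set y : V | x < y 0 i].
Proof.
pose k N : int := (Num.floor (N.+1%:R * (x - c 0 i) / q) + 1)%R.
have -> : [set y : V | x < y 0 i] =
    \bigcup_N [set y : V | (k N)%:~R * q <= N.+1%:R * (y 0 i - c 0 i)].
  apply/seteqP; split=> y /=; last first.
    move=> [N _]; have := floorD1_gt (N.+1%:R * (x - c 0 i) / q).
    rewrite ltr_pdivrMr// => /lt_le_trans /[apply].
    by rewrite ltr_pM2l// ltrD2r.
  move=> xy; exists (Num.truncn (q / (y 0 i - x))) => //=.
  set N := Num.truncn _.
  have d0 : 0 < y 0 i - x by rewrite subr_gt0.
  have /andP[_ tN] := truncn_itv (ltW (divr_gt0 q0 d0)).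
  have := floor_le (N.+1%:R * (x - c 0 i) / q); rewrite /k intrD.
  rewrite ler_pdivlMr// mulrDl mul1r => fl.
  move: tN; rewrite -/N ltr_pdivrMr// => tN.
  have := lerD fl (ltW tN) => /le_trans; apply.
  by rewrite -mulrDr ler_pM2l//; lra.
apply: approximable_bigcup => N.
have mN : measurable [set y : V | (k N)%:~R * q <= N.+1%:R * (y 0 i - c 0 i)].
  pose B := [set` `[((k N)%:~R * q / N.+1%:R + c 0 i), +oo[] : set R.
  rewrite (_ : [set _ | _] = setT `&` (fun y : V => y 0 i) @^-1` B).
    by apply: measurable_coor => //; exact: measurable_itv.
  apply/seteqP; split=> y; rewrite /B/= in_itv/= andbT -lerBrDr ler_pdivrMr//.
    by rewrite [_ * N.+1%:R]mulrC.
  by move=> [_]; rewrite [_ * N.+1%:R]mulrC.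
split=> // e e0; exists N.+1, [set y : V | (k N)%:~R * q <= N.+1%:R * (y 0 i - c 0 i)].
split=> //; first by move=> a b /= ab; rewrite ab.
by rewrite /symdiff setDv setU0 setI0 measure0 lte_fin.
Qed.

Lemma approximable_measurable A : measurable A -> approximable A.
Proof.
have sP : sigma_algebra setT approximable.
  split; [exact: approximable0| |exact: approximable_bigcup].
  by move=> B aB; rewrite setTD; exact: approximableC.
move: A; apply: smallest_sub => // A; rewrite -bigcup_seq => -[i _ [B mB <-]].
rewrite setTI.
pose G := [set B : set R | approximable ((fun y : V => y 0 i) @^-1` B)].
have : <<s @RGenOInfty.G R >> `<=` G.
  apply: smallest_sub.
    split.
    - by rewrite /G/= preimage_set0; exact: approximable0.
    - by move=> C; rewrite /G/= setTD preimage_setC; exact: approximableC.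
    - by move=> F HF; rewrite /G/= preimage_bigcup; exact: approximable_bigcup.
  move=> _ [x ->]; rewrite /G/= (_ : _ @^-1` _ = [set y : V | x < y 0 i]).
    exact: approximable_ray.
  by apply/seteqP; split=> y /=; rewrite in_itv/= andbT.
apply; move: mB; rewrite /measurable/=.
by have := RGenOInfty.measurableE R; rewrite /measurable/= => <-.
Qed.

End grid_approximation.

Lemma null_bigcup d (T : measurableType d) (R : realType)
    (mu : {measure set T -> \bar R}) (W : set T) (F : nat -> set T) :
  measurable W -> (forall k, measurable (F k)) -> W `<=` \bigcup_k F k ->
  (forall k, mu (W `&` F k) = 0)%E -> mu W = 0%E.
Proof.
move=> mW mF WF W0; have mWF k : measurable (W `&` F k) by exact: measurableI.
have : mu.-negligible (\bigcup_k (W `&` F k)).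
  by apply: negligible_bigcup => k; exists (W `&` F k); split=> //; exact: W0.
rewrite -setI_bigcupr => N; apply: measure_negligible => //.
by apply: negligibleS N => x Wx; split=> //; exact: WF.
Qed.

Lemma integrable_bounded d (T : measurableType d) (R : realType)
    (mu : {measure set T -> \bar R}) (A : set T) (f : T -> R) (M : R) :
  measurable A -> (mu A < +oo)%E -> measurable_fun A f ->
  (forall x, A x -> `|f x| <= M) -> mu.-integrable A (EFin \o f).
Proof.
move=> mA Afin mf fM; apply/integrableP; split; first exact/measurable_EFinP.
apply: (@le_lt_trans _ _ (\int[mu]_(x in A) (`|M|)%:E)%E).
  apply: ge0_le_integral => //=.
  - by apply/measurable_EFinP; apply: measurableT_comp.
  - by move=> x Ax; rewrite lee_fin (le_trans (fM x Ax))// ler_norm.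
by rewrite integral_cst//= lte_mul_pinfty// lee_fin.
Qed.

(** The error is relative to the approximant because the cube to be found must satisfy a bound
    relative to |a|. *)
Lemma rat_approx (R : realType) (y e : R) : y != 0 -> 0 < e ->
  exists t : rat, ratr t != 0 :> R /\ `|y - ratr t| <= e * `|ratr t|.
Proof.
(* Within this radius of y one has |t| >= |y|/(1 + e), and then e |t| is at least the radius. *)
move=> y0 e0; have d0 : 0 < `|y| * e / (1 + e).
  by rewrite divr_gt0 ?mulr_gt0 ?normr_gt0// addr_gt0.
have yd : y - `|y| * e / (1 + e) < y + `|y| * e / (1 + e).
  by apply: (@lt_trans _ _ y); rewrite ?ltrDl// ltrBlDr ltrDl.
have [t] := rat_in_itvoo yd.
rewrite in_itv/= -ltr_distl => yt; exists t.
have e1 : 0 < 1 + e by rewrite addr_gt0//.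
have ty : `|y| / (1 + e) <= `|ratr t|.
  rewrite (_ : _ / _ = `|y| - `|y| * e / (1 + e)); last by field; rewrite gt_eqF.
  rewrite lerBlDr addrC -lerBlDr (le_trans _ (ltW yt))//.
  by rewrite distrC; exact: lerB_dist.
split.
  by rewrite -normr_gt0 (lt_le_trans _ ty)// divr_gt0 ?normr_gt0.
rewrite distrC (le_trans (ltW yt))// (le_trans _ (ler_wpM2l (ltW e0) ty))//.
by rewrite mulrCA mulrA.
Qed.

(** * Density cubes for locally integrable functions *)

Section density.
Variables (R : realType) (n : nat).
Local Notation V := 'rV[R]_n.
Local Notation mu := (lebesgue_rV R n).

Lemma closed_cube_subcorner (c : V) s m (k : {ffun 'I_n -> 'I_m}) : 0 < s ->
  closed_cube (subcorner c s k) s `<=` closed_cube c (s * m%:R).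
Proof.
move=> s0 y yk i; have := yk i; rewrite mxE !ler_distl => /andP[h1 h2].
have : s * (k i)%:R + s <= s * m%:R.
  by rewrite -[X in _ + X]mulr1 -mulrDr ler_pM2l// natr1 ler_nat.
have : 0 <= s * (k i)%:R by rewrite mulr_ge0// ltW.
have : s <= s * m%:R.
  rewrite ler_peMr ?(ltW s0)// ler1n (leq_ltn_trans _ (ltn_ord (k i)))//.
by move=> *; apply/andP; split; lra.
Qed.

(** On the cell of index k every comparison defining saturation reduces to l <= k i, so the grid
    does not distinguish two points of the same cell. *)
Lemma saturated_cell (c : V) q M D (k : {ffun 'I_n -> 'I_M}) x y : 0 < q -> (0 < M)%N ->
  saturated c q M D -> cube (subcorner c (q / M%:R) k) (q / M%:R) x ->
  cube (subcorner c (q / M%:R) k) (q / M%:R) y -> D x -> D y.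
Proof.
move=> q0 M0 sD xk yk; apply: sD => i l.
have E z : cube (subcorner c (q / M%:R) k) (q / M%:R) z ->
    (l%:~R * q <= M%:R * (z 0 i - c 0 i)) = (l <= (k i)%:Z).
  move=> /(_ i); rewrite mxE => /andP[h1 h2].
  have M0' : 0 < M%:R :> R by rewrite ltr0n.
  have h1' : (k i)%:R * q <= M%:R * (z 0 i - c 0 i).
    move: h1; rewrite -lerBrDl -mulrA [_^-1 * _]mulrC mulrA ler_pdivrMr//.
    by rewrite [q * _]mulrC [_ * M%:R]mulrC.
  have h2' : M%:R * (z 0 i - c 0 i) < (k i).+1%:R * q.
    have -> : (k i).+1%:R * q = M%:R * (q / M%:R * (k i)%:R + q / M%:R).
      by rewrite -natr1; field; rewrite gt_eqF.
    by rewrite ltr_pM2l//; lra.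
  have [lk|kl] := leP l (k i)%:Z.
    apply: le_trans h1'; rewrite ler_pM2r//.
    by rewrite [leRHS]pmulrn ler_int.
  apply/negbTE; rewrite -ltNge; apply: (lt_le_trans h2'); rewrite ler_pM2r//.
  by rewrite [leLHS]pmulrn ler_int.
by rewrite !E.
Qed.

(* A set where w is close to some a <> 0 is approximated in measure by a union of
   grid cells; if w were far from a in the mean on each cell, this would fail
   on the union. *)
Lemma L1_density_cube (G : set V) (w : V -> R) (eta : R) :
  open G -> locally_L1 G w -> (0 < mu (G `&` [set x | (w x != 0)%R]))%E -> 0 < eta ->
  exists c s a, [/\ 0 < s, a != 0, closed_cube c s `<=` G &
    (\int[mu]_(x in cube c s) (`|w x - a|)%:E <= (eta * `|a| * s ^+ n)%:E)%E].
Proof.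
move=> oG [mw iw] w0 eta0.
have mG := measurable_open oG.
have mE (B : set R) : measurable B -> measurable (G `&` w @^-1` B) by exact: mw.
have mW : measurable (G `&` [set x | w x != 0]).
  rewrite (_ : [set x | w x != 0] = w @^-1` (~` [set 0])); last first.
    by apply/seteqP; split=> x /= /eqP.
  by apply: mE; exact: measurableC.
have [F [GF FE]] := open_bigcup_cube oG.
have [j Wj] : exists j, (mu (G `&` [set x | (w x != 0)%R] `&` F j) != 0)%E.
  apply/not_existsP => H.
  move: w0; have -> : mu (G `&` [set x | w x != 0]) = 0%E; last by rewrite ltxx.
  apply: (@null_bigcup _ _ _ _ _ F) => //.
  - by move=> k; case: (FE k) => [->//|[c [s [_ -> _]]]]; exact: measurable_cube.
  - by rewrite -GF; exact: subIsetl.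
  - by move=> k; apply: contrapT => /eqP; exact: H.
have [FE0|[c [q [q0 FQ QG]]]] := FE j.
  by move: Wj; rewrite FE0 setI0 measure0 eqxx.
pose eta' := eta / 2.
have eta'0 : 0 < eta' by rewrite divr_gt0.
(* Rational values make these near-level sets countable in number; they cover the points of [G]
   where [w] is nonzero, so one of them has positive measure in the cube. *)
pose B (t : rat) := G `&` [set x | `|w x - ratr t| <= eta' * `|ratr t|].
have mB t : measurable (B t).
  rewrite /B (_ : [set x | _] = w @^-1`
      `[ratr t - eta' * `|ratr t|, ratr t + eta' * `|ratr t|]).
    exact: mE.
  by apply/seteqP; split=> x /=; rewrite in_itv/= ler_distl.
have mQ := measurable_cube c q.
have [t [t0 At]] : exists t : rat, ratr t != 0 :> R /\ (mu (cube c q `&` B t) != 0)%E.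
  pose F' k := if unpickle k is Some t then
    if ratr t != 0 :> R then B t else set0 else set0.
  apply: contrapT => H; move/eqP: Wj; apply.
  apply: (@null_bigcup _ _ _ _ _ F').
  - by rewrite FQ; exact: measurableI.
  - by move=> k; rewrite /F'; case: unpickle => [t|//]; case: ifP.
  - move=> x [[Gx /= wx] _]; have [t [t0 wt]] := rat_approx wx eta'0.
    exists (pickle t); first exact: I.
    by rewrite /F' pickleK t0; split.
  - move=> k; rewrite /F'; case: unpickle => [t|]; last by rewrite setI0 measure0.
    case: ifPn => [t0|_]; last by rewrite setI0 measure0.
    have mI : measurable (cube c q `&` B t) by exact: measurableI.
    apply/eqP; rewrite -measure_le0; apply: (@le_trans _ _ (mu (cube c q `&` B t))).
      apply: le_measure; rewrite ?inE//.
        by rewrite FQ; apply: measurableI => //; exact: measurableI.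
      by rewrite FQ => x [[_ ?] ?].
    rewrite measure_le0; apply: contrapT => Bt; apply: H; exists t.
    by split=> //; exact/negP.
set a : R := ratr t in t0 At *.
pose A := cube c q `&` B t.
have mA : measurable A by exact: measurableI.
have Qfin : (mu (cube c q) < +oo)%E by rewrite lebesgue_cube ?ltry// ltW.
have Afin : (mu A < +oo)%E.
  by apply: le_lt_trans Qfin; apply: le_measure; rewrite ?inE//; exact: subIsetl.
have [m m0 mAE] : exists2 m : R, 0 < m & mu A = m%:E.
  exists (fine (mu A)); last by rewrite fineK// ge0_fin_numE.
  by rewrite fine_gt0// Afin lt0e At measure_ge0.
pose f : V -> R := fun x => `|w x - a| * \1_(cube c q) x.
have QG' : cube c q `<=` G by move=> x /cube_closed_cube/QG.
have mwQ : measurable_fun (cube c q) w by exact: measurable_funS mw.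
have mwa : measurable_fun (cube c q) (fun x => `|w x - a|).
  by apply: measurableT_comp => //; exact: measurable_funB.
have intf : mu.-integrable setT (EFin \o f).
  have iw' : mu.-integrable (cube c q) (EFin \o w).
    apply: (integrableS (measurable_closed_cube c q)) => //.
      exact: cube_closed_cube.
    exact: iw (@compact_closed_cube _ _ c q) QG.
  have ia : mu.-integrable (cube c q) (EFin \o cst a).
    by apply: (integrable_bounded (M := `|a|)).
  have ig : mu.-integrable (cube c q) (EFin \o (fun x => `|w x - a|)).
    exact: (integrable_abse (integrableB mQ iw' ia)).
  move/(integrable_mkcond _ mQ) : ig; apply: eq_integrable => // x _.
  by rewrite /f patchE/= indicE; case: ifPn => _; rewrite ?mulr1 ?mulr0.
(* Budget of the contradiction: failure on every cell gives at least 2 eta' |a| mu(Q [&] D), while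
   closeness on [A] and absolute continuity of the integral off [A] give at most eta' |a| (mu(Q [&]
   D) + m / 4). Choosing [D] within m / 2 of [A] keeps mu(Q [&] D) >= m / 2, which excludes both
   holding. *)
have e'0 : 0 < eta' * `|a| * m / 4.
  by rewrite divr_gt0// mulr_gt0// mulr_gt0// normr_gt0.
have [d [d0 dP]] := integral_normr_continuous intf e'0.
have := approximable_measurable c q0 mA => -[_].
have e0 : 0 < Num.min d (m / 2) by rewrite lt_min d0 divr_gt0.
move=> /(_ _ e0)[M [D [M0 mD sD]]]; rewrite EFin_min lt_min => /andP[De1 De2].
pose s := q / M%:R.
have s0 : 0 < s by rewrite divr_gt0// ltr0n.
have qE : s * M%:R = q by rewrite /s divfK// pnatr_eq0 -lt0n.
apply: contrapT => NH.
have Hk (k : {ffun 'I_n -> 'I_M}) : ((eta * `|a| * s ^+ n)%:E <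
    \int[mu]_(x in cube (subcorner c s k) s) (`|w x - a|)%:E)%E.
  rewrite ltNge; apply/negP => le; apply: NH.
  exists (subcorner c s k), s, a; split=> //.
  apply: subset_trans QG; rewrite -qE; exact: closed_cube_subcorner.
have mQD : measurable (cube c q `&` D) by exact: measurableI.
have lower : ((eta * `|a|)%:E * mu (cube c q `&` D) <=
    \int[mu]_(x in cube c q `&` D) (`|w x - a|)%:E)%E.
  have mgD : measurable_fun (cube c q) ((fun x => (`|w x - a|)%:E) \_ D).
    apply/(measurable_restrict _ mD mQ); apply/measurable_EFinP.
    by apply: measurable_funS mwa => //; exact: subIsetl.
  have mcD : measurable_fun (cube c q) ((fun=> (eta * `|a|)%:E) \_ D).
    exact/(measurable_restrict _ mD mQ).
  rewrite -integral_cst// !integral_mkcondr.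
  rewrite -{1 2}qE !ge0_integral_tiling ?qE//; last 2 first.
  - by move=> x _; apply: erestrict_ge0 => y _; rewrite lee_fin.
  - move=> x _; apply: erestrict_ge0 => y _.
    by rewrite lee_fin mulr_ge0// ltW.
  apply: lee_sum => k _; rewrite -!integral_mkcondr.
  (* By saturation a cell meeting [D] lies inside it, and there the failed estimate [Hk] applies;
     the other cells contribute nothing. *)
  have [[x [xk Dx]]|Dk] := pselect (exists x, cube (subcorner c s k) s x /\ D x).
    rewrite (_ : _ `&` D = cube (subcorner c s k) s); last first.
      apply/seteqP; split=> [y []//|y yk]; split=> //.
      exact: (saturated_cell q0 M0 sD xk yk Dx).
    rewrite integral_cst//; last exact: measurable_cube.
    apply: le_trans (ltW (Hk k)); rewrite [leRHS]EFinM.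
    by rewrite -(lebesgue_cube (subcorner c s k) (ltW s0)).
  rewrite (_ : _ `&` D = set0) ?integral_set0//.
  by apply/seteqP; split=> // y [yk Dy]; apply: Dk; exists y.
have upper : (\int[mu]_(x in cube c q `&` D) (`|w x - a|)%:E <=
    (eta' * `|a|)%:E * mu (cube c q `&` D) + (eta' * `|a| * m / 4)%:E)%E.
  have mDA : measurable (cube c q `&` D `&` A) by exact: measurableI.
  have mDA' : measurable ((cube c q `&` D) `\` A) by exact: measurableD.
  have -> : (\int[mu]_(x in cube c q `&` D) (`|w x - a|)%:E =
      \int[mu]_(x in cube c q `&` D `&` A) (`|w x - a|)%:E +
      \int[mu]_(x in (cube c q `&` D) `\` A) (`|w x - a|)%:E)%E.
    rewrite -ge0_integral_setU//.
    - by rewrite setUIDK.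
    - rewrite setUIDK; apply/measurable_EFinP; apply: measurable_funS mwa => //.
    - by apply/disj_setPS => x [[_ Ax] [_ NAx]]; exact: NAx.
  apply: leeD.
    apply: (@le_trans _ _
        (\int[mu]_(x in cube c q `&` D `&` A) cst (eta' * `|a|)%:E x)%E).
      apply: ge0_le_integral => //=.
      - apply/measurable_EFinP; apply: measurable_funS mwa => //.
        by move=> x [[]].
      - by move=> x [_ [_ [_ wx]]]; rewrite lee_fin.
    rewrite integral_cst//; apply: lee_wpmul2l; first by rewrite lee_fin mulr_ge0// ltW.
    by apply: le_measure; rewrite ?inE//; exact: subIsetl.
  have iDA : mu.-integrable ((cube c q `&` D) `\` A) (EFin \o f).
    exact: integrableS intf.
  have := dP _ mDA'.
  have : (mu ((cube c q `&` D) `\` A) < d%:E)%E.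
    apply: le_lt_trans De1; apply: le_measure; rewrite ?inE//.
      by apply: measurableI => //; exact: measurable_symdiff.
    by move=> x [[Qx Dx] NAx]; split=> //; right.
  move=> /[swap] /[apply] /ltW; rewrite -lee_fin; apply: le_trans.
  rewrite /Rintegral fineK; last first.
    exact: (integrable_fin_num mDA' (integrable_abse iDA)).
  rewrite le_eqVlt; apply/orP; left; apply/eqP; apply: eq_integral => x.
  rewrite inE => -[[Qx _] _]; congr EFin.
  by rewrite /f indicE mem_set// mulr1 normr_id.
have half : ((m / 2)%:E <= mu (cube c q `&` D))%E.
  have mS : measurable (cube c q `&` symdiff A D).
    by apply: measurableI => //; exact: measurable_symdiff.
  have : (m%:E <= mu (cube c q `&` D) + mu (cube c q `&` symdiff A D))%E.
    rewrite -mAE; apply: le_trans (measureU2 _ mQD mS).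
    apply: le_measure; rewrite ?inE//; first exact: measurableU.
    move=> x Ax; have [Qx _] := Ax; have [Dx|NDx] := pselect (D x); first by left.
    by right; split=> //; left.
  move=> /le_trans/(_ (leeD (lexx _) (ltW De2))).
  by rewrite -leeBlDr// -EFinB (_ : m - m / 2 = m / 2)//; lra.
have fD : mu (cube c q `&` D) \is a fin_num.
  rewrite ge0_fin_numE//; apply: le_lt_trans Qfin.
  by apply: le_measure; rewrite ?inE//; exact: subIsetl.
move: (le_trans lower upper) half; rewrite -(fineK fD) -!EFinM -EFinD !lee_fin.
set x := fine _.
have a0 : 0 < `|a| by rewrite normr_gt0.
have -> : eta * `|a| = 2 * (eta' * `|a|) by rewrite /eta'; field.
have : 0 < eta' * `|a| by rewrite mulr_gt0.
set z := eta' * `|a|.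
move=> z0 h1 h2.
move: h1 h2 z0 m0; clearbody z x; clear; move=> h1 h2 z0 m0.
have : z * x <= z * m / 4 by lra.
have := ler_wpM2l (ltW z0) h2.
have := mulr_gt0 z0 m0.
by move=> *; lra.
Qed.

End density.

(** * Cubes inside mesh elements *)

Section euclidean.
Variables (R : realType) (n : nat).
Local Notation V := 'rV[R]_n.
Implicit Types (x y c : V) (K A : set V).

Lemma coord_le_enorm x i : `|x 0 i| <= enorm x.
Proof.
rewrite /enorm /dotp -sqrtr_sqr ler_sqrt; last first.
  by apply: sumr_ge0 => j _; rewrite -expr2 sqr_ge0.
rewrite (bigD1 i)//= -expr2 lerDl; apply: sumr_ge0 => j _.
by rewrite -expr2 sqr_ge0.
Qed.

Lemma enorm_le x (e : R) : 0 <= e -> (forall i, `|x 0 i| <= e) ->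
  enorm x <= n%:R * e.
Proof.
move=> e0 xe; have [n0|n0] := posnP n.
  rewrite /enorm /dotp big1 ?sqrtr0 ?mulr_ge0// => i _.
  by have := ltn_ord i; rewrite {2}n0.
rewrite -[leRHS]ger0_norm ?mulr_ge0// -sqrtr_sqr ler_sqrt ?sqr_ge0//.
apply: (@le_trans _ _ (\sum_(i < n) e ^+ 2)).
  apply: ler_sum => i _; rewrite -expr2 -real_normK ?num_real//.
  by rewrite lerXn2r ?nnegrE.
rewrite sumr_const card_ord exprMn -[leLHS]mulr_natl ler_wpM2r ?sqr_ge0//.
by rewrite expr2 ler_peMl// ler1n.
Qed.

Lemma convex_polytope_conv K x y (t : R) : convex_polytope K -> K x -> K y ->
  0 <= t <= 1 -> K (x + t *: (y - x)).
Proof.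
move=> [m [v ->]] [a [a0 a1 ->]] [b [b0 b1 ->]] /andP[t0 t1].
exists (fun k => (1 - t) * a k + t * b k); split.
- by move=> k; rewrite addr_ge0// mulr_ge0// subr_ge0.
- by rewrite big_split/= -!mulr_sumr a1 b1; ring.
- rewrite scalerBr !scaler_sumr [X in _ + X]addrC addrA -sumrB -big_split/=.
  apply: eq_bigr => k _; rewrite scalerDl !scalerA mulrBl mul1r scalerBl.
  by [].
Qed.

Lemma convex_polytope_coord_bounded K : convex_polytope K ->
  exists2 B : R, 0 <= B & forall x i, K x -> `|x 0 i| <= B.
Proof.
move=> [m [v ->]]; exists (\sum_k \sum_i `|v k 0 i|).
  by apply: sumr_ge0 => k _; apply: sumr_ge0.
move=> x i [a [a0 a1 ->]]; rewrite summxE (le_trans (ler_norm_sum _ _ _))//.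
apply: ler_sum => k _; rewrite mxE normrM ger0_norm//.
have ak : a k <= 1.
  by rewrite -a1 (bigD1 k)//= lerDl; apply: sumr_ge0.
apply: (@le_trans _ _ `|v k 0 i|); first by rewrite ler_piMl.
by rewrite (bigD1 i)//= lerDl; apply: sumr_ge0.
Qed.

Lemma coord_bounded_enorm A (B : R) x y : 0 <= B ->
  (forall x i, A x -> `|x 0 i| <= B) ->
  A x -> A y -> enorm (x - y) <= n%:R * (2 * B).
Proof.
move=> B0 AB Ax Ay; apply: enorm_le => [|i]; first by rewrite mulr_ge0.
rewrite !mxE (le_trans (ler_normB _ _))// mulr2n mulrDl mul1r lerD//; exact: AB.
Qed.

(** The coordinate bound is required because [diam] is a real [sup], meaningful only for a nonempty
    set that is bounded above. *)
Lemma diam_ub A (B : R) x y : 0 <= B -> (forall x i, A x -> `|x 0 i| <= B) ->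
  A x -> A y -> enorm (x - y) <= diam A.
Proof.
move=> B0 AB Ax Ay; apply: sup_upper_bound; last by exists (x, y).
split; first by exists (enorm (x - y)), (x, y).
exists (n%:R * (2 * B)) => _ [[a b] [/= Aa Ab] <-].
exact: (coord_bounded_enorm B0 AB).
Qed.

Lemma diam_le A (B : R) : A !=set0 -> 0 <= B -> (forall x i, A x -> `|x 0 i| <= B) ->
  diam A <= n%:R * (2 * B).
Proof.
move=> [x Ax] B0 AB; apply: ge_sup; first by exists (enorm (x - x)), (x, x).
move=> _ [[a b] [/= Aa Ab] <-]; exact: (coord_bounded_enorm B0 AB).
Qed.

Lemma interior_ball K x : K° x -> exists2 e : R, 0 < e &
  forall y, (forall i, `|x 0 i - y 0 i| < e) -> K y.
Proof.
rewrite /interior -nbhs_ballE => -[e /= e0 eK]; exists e => // y xy.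
by apply: eK; split=> // i j; rewrite (ord1 i); exact: xy.
Qed.

Lemma ball_interior K x (e : R) : 0 < e ->
  (forall y, (forall i, `|x 0 i - y 0 i| < e) -> K y) -> K° x.
Proof.
move=> e0 eK; rewrite /interior -nbhs_ballE; exists e => //= y [_ xy].
by apply: eK => i; exact: xy.
Qed.

End euclidean.

Section mesh.
Variables (R : realType) (n : nat).
Hypothesis n_gt0 : (0 < n)%N.
Local Notation V := 'rV[R]_n.
Implicit Types (K : set V) (T : set (set V)).

Let i0 : 'I_n := Ordinal n_gt0.

(** Two opposite points of the ball along a coordinate axis are 2 rho apart. This bounds the set
    whose [sup] is [inscribed_diam]. *)
Lemma inscribed_ball_le_diam K (rho : R) c (B : R) : 0 <= B ->
  (forall x i, K x -> `|x 0 i| <= B) -> 0 <= rho ->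
  [set x | enorm (x - c) <= rho] `<=` K -> 2 * rho <= diam K.
Proof.
move=> B0 KB r0 bK; pose e : V := rho *: delta_mx 0 i0.
have ee : enorm e = rho.
  rewrite /enorm /dotp (bigD1 i0)//= !mxE !eqxx mulr1 big1 ?addr0.
    by rewrite -expr2 sqrtr_sqr ger0_norm.
  by move=> j /negPf ji; rewrite !mxE ji andbF mulr0 mul0r.
have ne : enorm (- e) = rho.
  rewrite -ee /enorm /dotp; congr Num.sqrt; apply: eq_bigr => j _.
  by rewrite !mxE mulrNN.
have K1 : K (c + e) by apply: bK => /=; rewrite addrAC subrr add0r ee.
have K2 : K (c - e) by apply: bK => /=; rewrite addrAC subrr add0r ne.
apply: le_trans (diam_ub B0 KB K1 K2).
apply: le_trans (coord_le_enorm _ i0); rewrite !mxE !eqxx mulr1.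
by rewrite ger0_norm; lra.
Qed.

(** Positivity makes the quotients in the regularity conditions genuine, since division by zero
    would return zero. The supremum over inscribed balls need not be known to be attained, hence the
    last clause with d strictly below it. *)
Lemma element_diam K : convex_polytope K -> K° !=set0 ->
  [/\ 0 < diam K, 0 < inscribed_diam K &
  forall d, d < inscribed_diam K ->
    exists rho c, [/\ 0 <= rho, d < 2 * rho & [set x | enorm (x - c) <= rho] `<=` K]].
Proof.
move=> /convex_polytope_coord_bounded[B B0 KB] [x Kx].
have [e e0 eK] := interior_ball Kx.
have bK : [set y | enorm (y - x) <= e / 2] `<=` K.
  move=> y /= ye; apply: eK => i; rewrite distrC.
  have := coord_le_enorm (y - x) i.
  rewrite !mxE => /le_trans/(_ ye) /le_lt_trans; apply.
  by rewrite ltr_pdivrMr// ltr_pMr// ltr1n.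
have e2 : 0 <= e / 2 by rewrite divr_ge0// ltW.
pose S := [set 2 * rho | rho in
    [set rho : R | 0 <= rho /\ exists c, [set x | enorm (x - c) <= rho] `<=` K]].
have Se : S (2 * (e / 2)) by exists (e / 2) => //; split=> //; exists x.
have S0 : has_sup S.
  split; first by exists (2 * (e / 2)).
  exists (diam K) => _ [rho [r0 [c cK]] <-].
  exact: (inscribed_ball_le_diam B0 KB r0 cK).
have ee : 0 < 2 * (e / 2) by rewrite mulr_gt0// divr_gt0.
split.
- by apply: (lt_le_trans ee); exact: (inscribed_ball_le_diam B0 KB e2 bK).
- by apply: (lt_le_trans ee); exact: sup_upper_bound.
- move=> d /sup_gt[|_ [rho [r0 [c cK]] <-] dr]; first by exists (2 * (e / 2)).
  by exists rho, c.
Qed.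

Lemma mesh_size_ub T K (D : R) : (forall K', T K' -> diam K' <= D) -> T K ->
  diam K <= mesh_size T.
Proof.
move=> TD TK; apply: sup_upper_bound; last by exists K.
split; first by exists (diam K), K.
by exists D => _ [K' TK' <-]; exact: TD.
Qed.

(* The homothety of centre [x] and ratio [s / (8 h)] maps [closed_cube c kappa]
   to a cube in [K] close to [x]; halving that cube moves it into the interior. *)
Lemma homothetic_cube K x c (kappa h s : R) : convex_polytope K ->
  closed_cube c kappa `<=` K -> K x -> (forall i, `|c 0 i - x 0 i| <= h) ->
  0 < kappa <= h -> 0 < s <= h ->
  exists c', closed_cube c' (kappa / h * s / 16) `<=` K° /\
    closed_cube c' (kappa / h * s / 16) `<=`
      [set y | forall i, `|y 0 i - x 0 i| < s / 2].
Proof.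
move=> Kc cK Kx cx /andP[k0 kh] /andP[s0 sh].
have h0 : 0 < h by exact: lt_le_trans sh.
pose t := s / (8 * h).
have t0 : 0 < t by rewrite divr_gt0// mulr_gt0.
have t1 : t <= 1 by rewrite ler_pdivrMr ?mulr_gt0//; lra.
have rE : kappa / h * s / 16 = t * kappa / 2 by rewrite /t; field; rewrite gt_eqF.
exists (x + t *: (c - x)); rewrite rE; split=> y yc.
  apply: (@ball_interior _ _ _ _ (t * kappa / 2)); first by rewrite divr_gt0// mulr_gt0.
  (* [c2] is the preimage of [z] under the homothety; it must be shown to lie in the given cube of
     [K]. *)
  move=> z yz; pose c2 := x + t^-1 *: (z - x).
  have -> : z = x + t *: (c2 - x).
    by rewrite /c2 addrAC subrr add0r scalerA divff ?gt_eqF// scale1r addrC subrK.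
  apply: convex_polytope_conv => //; last by rewrite ltW.
  apply: cK => i; rewrite !mxE.
  have -> : x 0 i + t^-1 * (z 0 i - x 0 i) - c 0 i =
      t^-1 * ((z 0 i - y 0 i) + (y 0 i - (x 0 i + t * (c 0 i - x 0 i)))).
    by field; rewrite gt_eqF.
  rewrite normrM ger0_norm ?invr_ge0 ?(ltW t0)// ler_pdivrMl//.
  rewrite (le_trans (ler_normD _ _))// (splitr (t * kappa)) lerD//.
    by rewrite distrC ltW.
  by have := yc i; rewrite !mxE.
move=> i; have := yc i; rewrite !mxE => yi.
have -> : y 0 i - x 0 i =
    (y 0 i - (x 0 i + t * (c 0 i - x 0 i))) + t * (c 0 i - x 0 i) by ring.
rewrite (le_lt_trans (ler_normD _ _))//.
apply: (@le_lt_trans _ _ (t * h / 2 + t * h)).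
  apply: lerD; first by rewrite (le_trans yi)// ler_pM2r// ler_pM2l.
  by rewrite normrM gtr0_norm// ler_pM2l.
by have -> : t * h / 2 + t * h = 3 / 16 * s; [rewrite /t; field; rewrite gt_eqF|lra].
Qed.

(** Regularity gives each element a ball of diameter comparable to its own, and quasi-uniformity
    makes that comparable to h. Since s is any length up to h, one constant theta serves all meshes
    and all cell sizes; [D] bounds all mesh sizes at once, through the size of the domain. *)
Lemma mesh_cubes (Om : set V) (I : Type) (T : I -> set (set V)) :
  Om !=set0 -> bounded_set Om -> (forall i, face_to_face_partition Om (T i)) ->
  quasi_uniform T ->
  exists theta D : R, [/\ 0 < theta, theta <= 1, 0 < D & forall i,
    0 < mesh_size (T i) <= D /\
    forall x s, Om x -> 0 < s <= mesh_size (T i) -> exists K c,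
      [/\ T i K, closed_cube c (theta * s) `<=` K° &
        closed_cube c (theta * s) `<=` [set y | forall i, `|y 0 i - x 0 i| < s / 2]]].
Proof.
move=> [x0 Omx0] bOm HT [[sigma sigma0 reg] [beta beta0 qu]].
have [B B0 OB] : exists2 B : R, 0 <= B & forall x i, closure Om x -> `|x 0 i| <= B.
  have [M [_ OM]] := bOm; exists (`|M| + 2) => [|x i cx]; first by rewrite addr_ge0.
  have [y [Oy [_ xy]]] := cx _ (nbhsx_ballx x 1 ltr01).
  have -> : x 0 i = x 0 i - y 0 i + y 0 i by rewrite subrK.
  rewrite (le_trans (ler_normD _ _))// [leRHS]addrC.
  have -> : 2 + `|M| = 1 + (`|M| + 1) by ring.
  rewrite lerD//; first by apply/ltW; exact: xy.
  have yM : `|y| <= `|M| + 1.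
    by apply: OM => //; rewrite (le_lt_trans (ler_norm M))// ltrDl.
  apply: le_trans yM; rewrite [leRHS]/Num.norm/= mx_normrE.
  by apply/bigmax_geP; right => /=; exists (0, i).
(* An inscribed ball has radius above diam K / (2 sigma), diam K >= h / beta, and n is the loss in
   [enorm_le]. The minimum with 1 ensures that the half-side of the cube is at most h. *)
pose theta0 := Num.min 1 (2 * sigma * beta * n%:R)^-1.
have n0 : 0 < n%:R :> R by rewrite ltr0n.
have theta00 : 0 < theta0 by rewrite lt_min ltr01 invr_gt0 !mulr_gt0.
have theta01 : theta0 <= 1 by rewrite ge_min lexx.
exists (theta0 / 16), (n%:R * (2 * B) + 1); split.
- by rewrite divr_gt0.
- by rewrite ler_pdivrMr// mul1r (le_trans theta01)// ler1n.
- by rewrite ltr_wpDl// mulr_ge0// mulr_ge0.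
move=> i; have [fT KT OT _] := HT i; set h := mesh_size _.
have elt x : Om x -> exists2 K, T i K & K x.
  by move=> /subset_closure; rewrite OT => -[K TK Kx]; exists K.
have [K0 TK0 K0x0] := elt _ Omx0.
have KB K : T i K -> forall x j, K x -> `|x 0 j| <= B.
  by move=> TK x j Kx; apply: OB; rewrite OT; exists K.
have diamD K : T i K -> diam K <= n%:R * (2 * B).
  move=> TK; have [_ [y Ky]] := KT _ TK.
  by apply: diam_le B0 (KB _ TK); exists y; exact: interior_subset.
have h0 : 0 < h.
  have [Kc Ki] := KT _ TK0; have [d0 _ _] := element_diam Kc Ki.
  exact: lt_le_trans d0 (mesh_size_ub diamD TK0).
split.
  rewrite h0/=; apply: ge_sup; first by exists (diam K0), K0.
  by move=> _ [K TK <-]; rewrite (le_trans (diamD _ TK))// lerDl.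
move=> x s Omx s0h; have [K TK Kx] := elt _ Omx.
have [Kc Ki] := KT _ TK; have [d0 I0 Hb] := element_diam Kc Ki.
have dI : diam K / sigma < inscribed_diam K.
  by rewrite ltr_pdivrMr// mulrC -ltr_pdivrMr//; exact: reg TK.
have [rho [c [rho0 drho cK]]] := Hb _ dI.
have hd : h <= beta * diam K by rewrite -ler_pdivrMr//; exact: qu TK.
have cubeK : closed_cube c (theta0 * h) `<=` K.
  move=> y yc; apply: cK => /=; apply: (@le_trans _ _ (n%:R * (theta0 * h))).
    apply: enorm_le => [|j]; first by rewrite mulr_ge0// ltW.
    by rewrite !mxE; exact: yc.
  apply: (@le_trans _ _ (n%:R * ((2 * sigma * beta * n%:R)^-1 * (beta * diam K)))).
    rewrite ler_pM2l// ler_pM ?(ltW theta00) ?(ltW h0)//.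
    by rewrite /theta0 ge_min lexx orbT.
  have -> : n%:R * ((2 * sigma * beta * n%:R)^-1 * (beta * diam K)) =
      diam K / sigma / 2.
    by field; rewrite !gt_eqF.
  by rewrite ler_pdivrMr// [leRHS]mulrC ltW.
have kh : 0 < theta0 * h <= h by rewrite mulr_gt0//= ler_piMl// ltW.
have cx j : `|c 0 j - x 0 j| <= h.
  have Kc0 : K c by apply: cubeK => l; rewrite subrr normr0 ltW//; case/andP: kh.
  have := coord_le_enorm (c - x) j; rewrite !mxE => /le_trans; apply.
  exact: le_trans (diam_ub B0 (KB _ TK) Kc0 Kx) (mesh_size_ub diamD TK).
have [c' [c'1 c'2]] := homothetic_cube Kc cubeK Kx cx kh s0h.
have rE : theta0 / 16 * s = theta0 * h / h * s / 16 by field; rewrite gt_eqF.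
by exists K, c'; rewrite rE; split.
Qed.

End mesh.

(** * Test functions supported in a cube *)

Section one_variable.
Variable R : realType.
Local Notation mu1 := (@lebesgue_measure R).
Implicit Types (a b : R) (f : R -> R) (g h : nat -> R -> R).

Lemma compact_support_integral f a b : continuous f ->
  (forall t, ~~ (a <= t <= b) -> f t = 0) ->
  mu1.-integrable setT (EFin \o f) /\
  \int[mu1]_t f t = \int[mu1]_(t in `[a, b]) f t.
Proof.
move=> cf f0.
have fE : f = f \_ `[a, b]%classic.
  apply/funext => t; rewrite patchE; case: ifPn => //.
  by rewrite notin_setE /= in_itv/= => /negP; exact: f0.
split; last by rewrite [RHS]Rintegral_mkcond -fE.
have iab : mu1.-integrable `[a, b] (EFin \o f).
  by apply: continuous_compact_integrable;
    [exact: segment_compact|exact: continuous_subspaceT].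
have : mu1.-integrable setT ((EFin \o f) \_ `[a, b]%classic).
  refine ((integrable_mkcond _ _).1 iab); exact: measurable_itv.
apply: eq_integrable => // t _; rewrite {2}fE /= !patchE.
by case: ifP.
Qed.

(** All orders of [h] vanish at both ends, so no boundary term survives when the derivatives are
    moved one at a time onto [g]. *)
Lemma iterated_integration_by_parts g h a b k m : a < b ->
  derivative_seq g -> derivative_seq h ->
  (forall l t, t <= a -> h l t = 0) -> (forall l t, b <= t -> h l t = 0) ->
  \int[mu1]_t (g k t * h m t) = (- 1) ^+ m * \int[mu1]_t (g (k + m)%N t * h 0%N t).
Proof.
move=> ab dg dh ha hb.
have cM i j : continuous (fun t => g i t * h j t).
  by move=> t; apply: cvgM; exact: continuous_derivative_seq.
have E i j : \int[mu1]_t (g i t * h j t) = \int[mu1]_(t in `[a, b]) (g i t * h j t).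
  apply: (compact_support_integral (cM i j) _).2 => t.
  by rewrite negb_and -!ltNge => /orP[/ltW/ha|/ltW/hb] ->; rewrite mulr0.
have LR s j : derivative_seq s -> derivable_oo_LRcontinuous (s j) a b.
  move=> ds; have cs := continuous_derivative_seq (k := j) ds; split.
  - by move=> t _; have [] := ds j t.
  - exact/cvg_at_right_filter/cs.
  - exact/cvg_at_left_filter/cs.
elim: m k => [|m ih] k; first by rewrite addn0 expr0 mul1r.
rewrite E (@Rintegration_by_parts _ (g k) (h m) (g k.+1))//.
- rewrite (hb _ b)// (ha _ a)// !mulr0 subrr sub0r -E ih exprS mulN1r mulNr.
  by rewrite addSnnS.
- exact/continuous_subspaceT/continuous_derivative_seq.
- exact: LR.
- by move=> t _; rewrite derive1E; have [_] := dg k t.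
- exact/continuous_subspaceT/continuous_derivative_seq.
- exact: LR.
- by move=> t _; rewrite derive1E; have [_] := dh m t.
Qed.

End one_variable.

Section cutoff.
Variables (R : realType) (n : nat) (c : 'rV[R]_n) (rho : R).
Hypothesis rho_gt0 : 0 < rho.
Local Notation V := 'rV[R]_n.
Local Notation mu := (lebesgue_rV R n).
Local Notation mu1 := (@lebesgue_measure R).
Implicit Types (m a gamma : 'I_n -> nat).

(** The power of 1/rho is the chain rule factor: these are the successive derivatives of the
    rescaled bump, so that [cutoff m] is the derivative of multi-index [m] of the cutoff. *)
Definition cutoff_factor (i : 'I_n) k (t : R) : R :=
  rho^-1 ^+ k * bumpf k ((t - c 0 i) / rho).

Definition cutoff m : V -> R := prodfun cutoff_factor m.

Lemma derivative_seq_cutoff i : derivative_seq (cutoff_factor i).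
Proof.
move=> k t; rewrite /cutoff_factor.
have d1 : is_derive t 1 (fun t : R => (t - c 0 i) / rho) rho^-1.
  by apply: is_derive_eq; rewrite /GRing.scale/=; field; rewrite gt_eqF.
have := @is_derive1_comp _ (bumpf k) (fun t => (t - c 0 i) / rho) t _ _
  (is_derive_bump _ _) d1.
move=> /(@is_deriveZ _ _ _ _ (rho^-1 ^+ k)) d2; apply: (is_derive_eq d2).
by rewrite /GRing.scale/= exprSr; ring.
Qed.

Lemma cutoff_factor_out i k t : rho <= `|t - c 0 i| -> cutoff_factor i k t = 0.
Proof.
move=> tc; rewrite /cutoff_factor bump_out ?mulr0//.
by rewrite normrM normfV (gtr0_norm rho_gt0) ler_pdivlMr// mul1r.
Qed.

Lemma cutoff_out m x : ~ closed_cube c rho x -> cutoff m x = 0.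
Proof.
move=> /existsNP[i /negP]; rewrite -ltNge => /ltW xi.
by rewrite /cutoff /prodfun (bigD1 i)//= cutoff_factor_out// mul0r.
Qed.

Lemma cutoff_test (U : set V) m : closed_cube c rho `<=` U ->
  test_function U (cutoff m).
Proof.
move=> cU; split; first by apply: smooth_prodfun => i; exact: derivative_seq_cutoff.
exists (closed_cube c rho); split=> //; first exact: compact_closed_cube.
by move=> x; exact: cutoff_out.
Qed.

Lemma Dpartial_cutoff m a : Dpartial a (cutoff m) = cutoff (fun j => m j + a j)%N.
Proof. by apply: Dpartial_prodfun => i; exact: derivative_seq_cutoff. Qed.

Lemma measurable_cutoff (D : set V) m : measurable_fun D (cutoff m).
Proof.
apply: measurable_funTS; apply: measurable_prod => i _.
apply: (@measurableT_comp _ _ _ _ _ _ (cutoff_factor i (m i))); last first.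
  exact: measurable_coor.
apply: continuous_measurable_fun.
exact/continuous_derivative_seq/derivative_seq_cutoff.
Qed.

(** Origin of the negative power of the mesh size: applied with |m| = r - j and rho comparable to
    h. *)
Lemma cutoff_bound (M : R) m x : (forall i t, `|bumpf (m i) t| <= M) ->
  `|cutoff m x| <= rho^-1 ^+ mi_order m * M ^+ n.
Proof.
move=> bM; rewrite /cutoff /prodfun normr_prod /cutoff_factor.
under eq_bigr do rewrite normrM.
rewrite big_split/= /mi_order; apply: ler_pM.
- by apply: prodr_ge0.
- by apply: prodr_ge0.
- rewrite expr_sum; apply: ler_prod => i _; rewrite normr_ge0/=.
  by rewrite ger0_norm// exprn_ge0// invr_ge0 ltW.
- rewrite -[n in _ ^+ n]card_ord -prodr_const; apply: ler_prod => i _.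
  by rewrite normr_ge0/=; exact: bM.
Qed.

Lemma cutoff0_ge0 x : 0 <= cutoff (fun=> 0%N) x.
Proof.
by apply: prodr_ge0 => i _; rewrite /cutoff_factor expr0 mul1r bump_ge0.
Qed.

Lemma cutoff0_le1 x : cutoff (fun=> 0%N) x <= 1.
Proof.
have -> : 1 = \prod_(i < n) (1 : R) by rewrite big1.
apply: ler_prod => i _; rewrite /cutoff_factor expr0 mul1r.
by rewrite bump_ge0 bump_le1.
Qed.

Lemma cutoff0_gt x : closed_cube c (rho / 2) x ->
  expR (- 2) ^+ n <= cutoff (fun=> 0%N) x.
Proof.
move=> xc; rewrite -[n in _ ^+ n]card_ord -prodr_const.
apply: ler_prod => i _; rewrite expR_ge0/= /cutoff_factor expr0 mul1r.
apply: bump_gt; rewrite normrM normfV (gtr0_norm rho_gt0) ler_pdivrMr//.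
by rewrite mulrC; exact: xc.
Qed.

End cutoff.

Section real_integrals.
Context d (T : measurableType d) (R : realType) (mu : {measure set T -> \bar R}).
Implicit Types (D S : set T) (f h : T -> R).

Lemma integrable_mul_bounded D f h (B : R) : measurable D ->
  mu.-integrable D (EFin \o f) -> measurable_fun D h ->
  (forall x, D x -> `|h x| <= B) ->
  mu.-integrable D (EFin \o (fun x => f x * h x)).
Proof.
move=> mD intf mh hB; have bh : [bounded h x | x in D].
  exists B; split=> [|M BM x Dx]; first exact: num_real.
  exact: le_trans (hB x Dx) (ltW BM).
have := integrableMl mD intf mh bh; by apply: eq_integrable.
Qed.

Lemma Rintegral_support D S f : S `<=` D -> (forall x, ~ S x -> f x = 0) ->
  \int[mu]_(x in D) f x = \int[mu]_(x in S) f x.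
Proof.
move=> SD f0; rewrite Rintegral_mkcond [RHS]Rintegral_mkcond.
apply: eq_Rintegral => x _; rewrite !patchE; case: ifPn => xD; case: ifPn => xS //.
  by apply: f0; move: xS; rewrite notin_setE.
by move: xD; rewrite notin_setE => /(_ (SD _ (set_mem xS))).
Qed.

Lemma Rintegral_sum D (J : Type) (s : seq J) (F : J -> T -> R) : measurable D ->
  (forall l, mu.-integrable D (EFin \o F l)) ->
  mu.-integrable D (EFin \o (fun x => \sum_(l <- s) F l x)) /\
  \int[mu]_(x in D) (\sum_(l <- s) F l x) = \sum_(l <- s) \int[mu]_(x in D) F l x.
Proof.
move=> mD iF; elim: s => [|l s [ih1 ih2]].
  have -> : (fun x => \sum_(l <- [::]) F l x) = (fun=> 0).
    by apply/funext => x; rewrite big_nil.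
  by rewrite big_nil Rintegral_cst// mul0r; split=> //; exact: integrable0.
split.
  have := integrableD mD (iF l) ih1; apply: eq_integrable => // x _.
  by rewrite /= big_cons.
under eq_Rintegral do rewrite big_cons.
by rewrite RintegralD// ih2 big_cons.
Qed.

End real_integrals.

Lemma Rintegral_prod_rV (R : realType) n (g : 'I_n -> R -> R) :
  (forall i, (@lebesgue_measure R).-integrable setT (EFin \o g i)) ->
  \int[lebesgue_rV R n]_x (\prod_i g i (x 0 i)) =
  \prod_i \int[@lebesgue_measure R]_t g i t.
Proof.
move=> ig; rewrite /Rintegral (integral_prod_rV ig).2.
transitivity (fine (\prod_i (fine (\int[@lebesgue_measure R]_t (g i t)%:E))%:E)%E).
  congr fine; apply: eq_bigr => i _; rewrite fineK//.
  exact: integrable_fin_num (ig i).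
by rewrite prodEFin.
Qed.

(** * Integration by parts against a cutoff on one cube *)

Section local_estimate.
Variables (R : realType) (n : nat).
Local Notation V := 'rV[R]_n.
Local Notation mu := (lebesgue_rV R n).
Local Notation mu1 := (@lebesgue_measure R).
Implicit Types (m alpha beta gamma : 'I_n -> nat) (U G : set V).

Lemma Dpartial_local U gamma (f g : V -> R) : open U ->
  (forall x, U x -> f x = g x) ->
  forall x, U x -> Dpartial gamma f x = Dpartial gamma g x.
Proof.
move=> oU; have L i (f' g' : V -> R) : (forall x, U x -> f' x = g' x) ->
    forall x, U x -> partial i f' x = partial i g' x.
  move=> fg x Ux; apply: near_eq_derive.
  have : nbhs x U by exact: open_nbhs_nbhs.
  by apply: filterS => y; exact: fg.
rewrite /Dpartial; elim: (enum 'I_n) => //= i s ih fg; move: (ih fg) => {ih}.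
elim: (gamma i) => //= k ih H; apply: L; exact: ih.
Qed.

(** Formal polynomial derivatives, so that monomials fit the same product format as the cutoffs. *)
Definition monomial_seq (a : 'I_n -> nat) (i : 'I_n) k (t : R) : R :=
  (('X^(a i) : {poly R})^`(k)).[t].

Lemma derivative_seq_monomial a i : derivative_seq (monomial_seq a i).
Proof. by move=> k t; rewrite /monomial_seq derivnS; exact: is_derive_poly. Qed.

Variables (c : V) (rho : R).
Hypothesis rho_gt0 : 0 < rho.
Local Notation S := (closed_cube c rho).
Local Notation cut := (cutoff c rho).

Lemma cutoff_bounded m : exists B : R, forall x, `|cut m x| <= B.
Proof.
have /choice[M HM] : forall i : 'I_n, exists M : R, forall t, `|bumpf (m i) t| <= M.
  by move=> i; have [M _ HM] := bump_bounded R (m i); exists M.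
exists (rho^-1 ^+ mi_order m * (\sum_i M i) ^+ n) => x.
apply: cutoff_bound => // i t; rewrite (le_trans (HM i t))// (bigD1 i)//= lerDl.
by apply: sumr_ge0 => j _; exact: le_trans (normr_ge0 _) (HM j 0).
Qed.

(** On each product term the integral factors into one-variable integrals, where gamma is moved from
    the cutoff to the polynomial. The derivative has to vanish only on the cube, since the cutoff is
    zero elsewhere. *)
Lemma cutoff_orthogonal (A : finType) (C : A -> R) (D : A -> 'I_n -> nat -> R -> R)
    gamma : (forall l i, derivative_seq (D l i)) ->
  (forall x, S x -> prodfun_sum C D gamma x = 0) ->
  \int[mu]_(x in S) (prodfun_sum C D (fun=> 0%N) x * cut gamma x) = 0.
Proof.
move=> HD PS; pose m0 : 'I_n -> nat := fun=> 0%N.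
rewrite -(@Rintegral_support _ _ _ _ setT)//; last first.
  by move=> x Sx; rewrite cutoff_out ?mulr0.
have ig l p q i : mu1.-integrable setT
    (EFin \o (fun t => D l i p t * cutoff_factor c rho i q t)).
  apply: (@compact_support_integral _ _ (c 0 i - rho) (c 0 i + rho) _ _).1.
    by move=> t; apply: cvgM; apply: continuous_derivative_seq => //;
      exact: derivative_seq_cutoff.
  move=> t tc; rewrite cutoff_factor_out ?mulr0//.
  by move: tc; rewrite -ler_distl -ltNge => /ltW.
have PE p q x : prodfun_sum C D p x * cut q x =
    \sum_(l : A) C l *
      \prod_i (D l i (p i) (x 0 i) * cutoff_factor c rho i (q i) (x 0 i)).
  rewrite /prodfun_sum mulr_suml; apply: eq_bigr => l _.
  by rewrite -mulrA -big_split.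
have iF l p q : mu.-integrable setT (EFin \o (fun x : V => C l *
    \prod_i (D l i (p i) (x 0 i) * cutoff_factor c rho i (q i) (x 0 i)))).
  have [H _] := integral_prod_rV (fun i => ig l (p i) (q i) i).
  have := integrableZl measurableT (C l) H; by apply: eq_integrable.
have IE p q : \int[mu]_x (prodfun_sum C D p x * cut q x) =
    \sum_(l : A) C l *
      \prod_i \int[mu1]_t (D l i (p i) t * cutoff_factor c rho i (q i) t).
  under eq_Rintegral do rewrite PE.
  rewrite (Rintegral_sum _ measurableT (fun l => iF l p q)).2.
  apply: eq_bigr => l _; rewrite RintegralZl//.
    by rewrite (Rintegral_prod_rV (fun i => ig l (p i) (q i) i)).
  by have [] := integral_prod_rV (fun i => ig l (p i) (q i) i).
transitivity ((- 1) ^+ mi_order gamma *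
    \int[mu]_x (prodfun_sum C D gamma x * cut m0 x)).
  rewrite !IE mulr_sumr; apply: eq_bigr => l _; rewrite mulrCA; congr (_ * _).
  rewrite /mi_order expr_sum -big_split; apply: eq_bigr => i _.
  rewrite (@iterated_integration_by_parts _ _ _ (c 0 i - rho) (c 0 i + rho) 0) ?add0n//.
  - by rewrite ltrBlDr -addrA ltrDl addr_gt0.
  - exact: derivative_seq_cutoff.
  - move=> k t tc; apply: cutoff_factor_out => //.
    by rewrite distrC ler_normr; apply/orP; left; lra.
  - move=> k t tc; apply: cutoff_factor_out => //.
    by rewrite ler_normr; apply/orP; left; lra.
under eq_Rintegral => x _.
  rewrite (_ : _ * _ = 0); last first.
    have [Sx|NSx] := pselect (S x); first by rewrite PS ?mul0r.
    by rewrite cutoff_out ?mulr0.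
  over.
by rewrite Rintegral_cst// mul0r mulr0.
Qed.

(** Up to sign, the integral of w phi is that of u D^gamma phi, then that of (u - v) D^alpha D^beta
    phi by the orthogonality of [v], then that of z D^beta phi. The two weak derivatives live on
    different sets [G] and [U], of which only the common cube matters. *)
Lemma local_identity U G (u v w z : V -> R) alpha beta gamma :
  measurable U -> measurable G -> S `<=` U -> S `<=` G ->
  gamma = (fun j => beta j + alpha j)%N ->
  weak_derivative G gamma u w -> weak_derivative U alpha (u \- v)%R z ->
  \int[mu]_(x in S) (v x * cut gamma x) = 0 ->
  `|\int[mu]_(x in S) (w x * cut (fun=> 0%N) x)| =
  `|\int[mu]_(x in S) (z x * cut beta x)|.
Proof.
move=> mU mG SU SG gE [[mu_ iu] _ uw] [[mv iv] _ vz] v0.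
have cS : compact S by exact: compact_closed_cube.
have mS : measurable S by exact: measurable_closed_cube.
have out (f : V -> R) m x : ~ S x -> f x * cut m x = 0.
  by move=> Sx; rewrite cutoff_out ?mulr0.
have := uw _ (cutoff_test rho_gt0 (fun=> 0%N) SG).
rewrite Dpartial_cutoff//.
have := vz _ (cutoff_test rho_gt0 beta SU).
rewrite Dpartial_cutoff// -gE.
rewrite !(Rintegral_support _ SU (out _ _)) !(Rintegral_support _ SG (out _ _)).
have iuS := iu _ cS SG; have ivS := iv _ cS SU.
have [B HB] := cutoff_bounded gamma.
have E : \int[mu]_(x in S) ((u \- v)%R x * cut gamma x) =
    \int[mu]_(x in S) (u x * cut gamma x).
  (* Integrability of [v] is recovered as the difference of u and u - v, both locally integrable by
     their weak derivatives. *)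
  have ivS' : mu.-integrable S (EFin \o v).
    have := integrableB mS iuS ivS; apply: eq_integrable => // x _ /=.
    by rewrite -EFinB; congr EFin; rewrite opprB addrCA subrr addr0.
  under eq_Rintegral do rewrite mulrBl.
  rewrite RintegralB// ?v0 ?subr0//.
    by apply: (integrable_mul_bounded (B := B)) => //; exact: measurable_cutoff.
  by apply: (integrable_mul_bounded (B := B)) => //; exact: measurable_cutoff.
rewrite E => -> /(congr1 (fun x => `|x|)).
by rewrite !normrM !normrX !normrN !normr1 !expr1n !mul1r => ->.
Qed.

End local_estimate.

From mathcomp Require Import finmap.

(** * Sobolev norms *)

Section lp_sums.
Variable R : realType.

Lemma lp_sum_ge (J : choiceType) (p : \bar R) (A : set J) (F : J -> \bar R) k :
  (1 <= p)%E -> finite_set A -> (0 <= F k)%E -> A k ->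
  (F k <= lp_sum p A F)%E.
Proof.
move=> p1 fA Fk0 Ak; case: p p1 => [q|_|//]; last first.
  by apply: ereal_sup_ubound; exists k.
rewrite lee_fin /= => q1; have q0 : 0 < q by exact: lt_le_trans q1.
have -> : F k = ((F k `^ q) `^ q^-1)%E.
  by rewrite -poweRrM divff ?gt_eqF// poweRe1.
apply: gt0_ler_poweR; rewrite ?invr_ge0 ?(ltW q0)//.
- by rewrite in_itv/= poweR_ge0 leey.
- rewrite in_itv/= leey andbT; rewrite fsbig_finite//=.
  by apply: sume_ge0 => l _; exact: poweR_ge0.
rewrite fsbig_finite//= (bigD1_seq k)/= ?fset_uniq ?in_fset_set ?mem_set//.
by rewrite leeDl//; apply: sume_ge0 => l _; exact: poweR_ge0.
Qed.

Lemma lp_sum_lt (J : choiceType) (q : R) (A : set J) (F : J -> \bar R) (lam : R) :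
  0 < q -> finite_set A -> 0 < lam -> (lp_sum q%:E A F < lam%:E)%E ->
  (\sum_(k <- fset_set A) F k `^ q <= (lam `^ q)%:E)%E.
Proof.
move=> q0 fA lam0; rewrite /lp_sum fsbig_finite//= => /ltW.
set X := (\sum_(_ <- _) _)%E.
have X0 : (0 <= X)%E by apply: sume_ge0 => l _; exact: poweR_ge0.
move=> XL; have -> : X = ((X `^ q^-1) `^ q)%E.
  by rewrite -poweRrM mulVf ?gt_eqF// poweRe1.
rewrite -poweR_EFin; apply: gt0_ler_poweR => //; rewrite ?(ltW q0)//.
- by rewrite in_itv/= poweR_ge0 leey.
- by rewrite in_itv/= lee_fin (ltW lam0) leey.
Qed.

End lp_sums.

Section norms.
Variables (R : realType) (n : nat).
Local Notation V := 'rV[R]_n.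
Local Notation mu := (lebesgue_rV R n).

Lemma Lp_norm_powR (G : set V) (q : R) (w : V -> R) : 0 < q ->
  (Lp_norm G q%:E w `^ q)%E = (\int[mu]_(x in G) (`|w x| `^ q)%:E)%E.
Proof.
move=> q0; rewrite /Lp_norm poweR_Lnorm ?gt_eqF// [RHS]integral_mkcond.
apply: eq_integral => x _; rewrite patchE indicE; case: ifPn => xG.
  by rewrite mulr1 abse_EFin poweR_EFin.
by rewrite mulr0 abse_EFin normr0 poweR_EFin powR0 ?gt_eqF.
Qed.

(** The norm of exponent infinity is 0 by convention on a space of measure zero, hence the
    positivity hypothesis. *)
Lemma Lp_norm_pinfty_lt (G : set V) (w : V -> R) (lam : R) :
  (0 < mu [set: V])%E ->
  (Lp_norm G +oo%E w <= lam%:E)%E -> {ae mu, forall x, G x -> `|w x| <= lam}.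
Proof.
move=> mu0; rewrite /Lp_norm unlock mu0 => /ess_supP.
apply: filterS => x /= + Gx; rewrite indicE mem_set// mulr1.
by rewrite lee_fin.
Qed.

Lemma Lp_norm_gt0 (G : set V) (p : \bar R) (w : V -> R) : (1 <= p)%E ->
  measurable G -> measurable_fun G w -> (0 < Lp_norm G p w)%E ->
  (0 < mu (G `&` [set x | (w x != 0)%R]))%E.
Proof.
move=> p1 mG mw; apply: contraTT; rewrite -!leNgt measure_le0 => /eqP W0.
pose f : V -> \bar R := fun x => (w x * \1_G x)%:E.
have mW : measurable (G `&` [set x | (w x != 0)%R]).
  rewrite (_ : [set x | _] = w @^-1` (~` [set 0])); last first.
    by apply/seteqP; split=> x /= /eqP.
  by apply: mw => //; exact: measurableC.
have f0 : {ae mu, forall x, f x = 0%E}.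
  exists (G `&` [set x | (w x != 0)%R]); split=> // x /= fx; split.
    apply: contrapT => Gx; apply: fx; rewrite /f indicE memNset// mulr0//.
  by apply/negP => /eqP wx; apply: fx; rewrite /f wx mul0r.
rewrite /Lp_norm -/f; case: p p1 => [q| |//].
  rewrite lee_fin => q1; have q0 : 0 < q by exact: lt_le_trans q1.
  have mf : measurable_fun setT f.
    apply/measurable_EFinP; have := (measurable_restrictT w mG).1 mw.
    congr measurable_fun; apply/funext => x; rewrite patchE indicE.
    by case: ifPn => _; rewrite ?mulr1 ?mulr0.
  rewrite unlock (_ : \int[mu]_x _ = 0)%E ?poweR0r ?invr_eq0 ?gt_eqF//.
  rewrite (@ge0_ae_eq_integral _ _ _ mu setT _ (cst 0%E))//.
  - by rewrite integral_cst// mul0e.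
  - rewrite [X in measurable_fun _ X](_ : _ = (fun x => (`|w x * \1_G x| `^ q)%:E)).
      apply/measurable_EFinP; apply: (measurableT_comp (measurable_powR q)).
      by apply: measurableT_comp => //; exact/measurable_EFinP.
    by apply/funext => x; rewrite -poweR_EFin.
  - by move=> x _; exact: poweR_ge0.
  - apply: filterS f0 => x fx _.
    by rewrite [X in (`|X| `^ q)%E](fx : _ = 0%E) abse0 poweR0r ?gt_eqF.
move=> _; rewrite unlock; case: ifPn => // _; apply/ess_supP.
by apply: filterS f0 => x fx; rewrite /comp [X in (`|X|)%E](fx : _ = 0%E) abse0.
Qed.

Lemma weak_derivative_wD (k : nat) (G : set V) (v : V -> R) (a : 'I_n -> nat) :
  weakly_differentiable k G v -> (mi_order a <= k)%N ->
  weak_derivative G a v (wD G a v).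
Proof.
move=> wd ak; have [w Hw] := wd a ak.
exact: (@xgetPex _ _ [set w | weak_derivative G a v w]) (ex_intro _ w Hw).
Qed.

(** A bound by [lam] on one derivative over all elements, without roots: q-th powers are summed for
    a finite exponent, and the bound is almost everywhere for an infinite one. *)
Definition elementwise_Lp_le (T : set (set V)) (p : \bar R) (z : set V -> V -> R)
    (lam : R) : Prop :=
  match p with
  | q%:E => (\sum_(K <- fset_set T) \int[mu]_(x in K°) (`|z K x| `^ q)%:E
               <= (lam `^ q)%:E)%E
  | _ => forall K, T K -> {ae mu, forall x, K° x -> `|z K x| <= lam}
  end.

(** Meant for a proof by contradiction: a finite bound forces weak differentiability on every
    element, because the Sobolev norm is [+oo] otherwise. An error lacking derivatives of order j
    thus needs no separate treatment. *)
Lemma piecewise_norm_lt (T : set (set V)) (p : \bar R) (v : V -> R)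
    (alpha : 'I_n -> nat) (lam : R) :
  (1 <= p)%E -> finite_set T -> (0 < mu [set: V])%E -> 0 < lam ->
  (piecewise_norm (mi_order alpha) p T v < lam%:E)%E ->
  (forall K, T K -> weak_derivative K° alpha v (wD K° alpha v)) /\
  elementwise_Lp_le T p (fun K => wD K° alpha v) lam.
Proof.
move=> p1 fT mu0 lam0 N; set j := mi_order alpha in N *.
have jle i : (alpha i <= j)%N by rewrite /j /mi_order (bigD1 i)//= leq_addr.
(* Each entry of [alpha] is at most its order j, so [inord] loses nothing. *)
pose al : {ffun 'I_n -> 'I_j.+1} := [ffun i => inord (alpha i)].
have alE : multi_index al = alpha.
  by apply/funext => i; rewrite /multi_index ffunE inordK// ltnS.
have fin_al : finite_set
    [set a : {ffun 'I_n -> 'I_j.+1} | (mi_order (multi_index a) <= j)%N].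
  exact: finite_finset.
have L0 K (a : {ffun 'I_n -> 'I_j.+1}) : (0 <= Lp_norm K p (wD K (multi_index a) v))%E.
  exact: Lnorm_ge0.
have Lle K : weakly_differentiable j K v ->
    (Lp_norm K p (wD K alpha v) <= sobolev_norm_nat j p K v)%E.
  move=> wd; rewrite /sobolev_norm_nat asboolT// -{1}alE.
  apply: (@lp_sum_ge _ _ p _
    (fun a => Lp_norm K p (wD K (multi_index a) v)) al p1) => //.
  by rewrite /= alE.
have sob_ge0 K : (0 <= sobolev_norm_nat j p K v)%E.
  have [wd|wd] := pselect (weakly_differentiable j K v).
    by apply: le_trans (Lle K wd); exact: Lnorm_ge0.
  by rewrite /sobolev_norm_nat asboolF// leey.
have sobK K : T K -> (sobolev_norm_nat j p K° v < +oo)%E.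
  move=> TK; apply: le_lt_trans (lt_trans N (ltry lam)).
  exact: (@lp_sum_ge _ _ p T (fun K => sobolev_norm_nat j p K° v)).
have wdK K : T K -> weakly_differentiable j K° v.
  by move=> /sobK; rewrite /sobolev_norm_nat; case: asboolP => //; rewrite ltxx.
split.
  by move=> K TK; exact: weak_derivative_wD (wdK K TK) (leqnn _).
case: p p1 N L0 sob_ge0 sobK Lle => [q| |//] p1 N L0 sob_ge0 sobK Lle; last first.
  move=> K TK; apply: Lp_norm_pinfty_lt => //.
  apply: (le_trans (Lle _ (wdK _ TK))); apply/ltW/(le_lt_trans _ N).
  exact: (@lp_sum_ge _ _ +oo%E T (fun K => sobolev_norm_nat j +oo%E K° v)).
have q0 : 0 < q by rewrite lee_fin in p1; exact: lt_le_trans p1.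
apply: le_trans (lp_sum_lt q0 fT lam0 N).
rewrite [leLHS]big_seq [leRHS]big_seq; apply: lee_sum => K.
rewrite in_fset_set// => /set_mem TK; rewrite -Lp_norm_powR//.
apply: gt0_ler_poweR; rewrite ?(ltW q0) ?in_itv/= ?leey ?andbT//.
- exact: Lnorm_ge0.
- exact: (Lle _ (wdK _ TK)).
Qed.

End norms.

(** * The lower bound *)

Section lower_bounds.
Variables (R : realType) (n : nat).
Local Notation V := 'rV[R]_n.
Local Notation mu := (lebesgue_rV R n).

(** Write a phi = w phi - (w - a) phi and use 0 <= phi <= 1. The integral of phi is bounded below on
    the concentric cube of side rho, where phi >= e^(-2n). *)
Lemma local_lower (c : V) (rho a M : R) (w z : V -> R) (beta : 'I_n -> nat) :
  0 < rho ->
  mu.-integrable (closed_cube c rho) (EFin \o w) ->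
  mu.-integrable (closed_cube c rho) (EFin \o z) ->
  `|\int[mu]_(x in closed_cube c rho) (w x * cutoff c rho (fun=> 0%N) x)| =
  `|\int[mu]_(x in closed_cube c rho) (z x * cutoff c rho beta x)| ->
  (forall i t, `|bumpf (beta i) t| <= M) ->
  `|a| * (expR (- 2) * rho) ^+ n
    - \int[mu]_(x in closed_cube c rho) `|w x - a|
  <= rho^-1 ^+ mi_order beta * M ^+ n * \int[mu]_(x in closed_cube c rho) `|z x|.
Proof.
move=> rho0 iw iz E bM; set S := closed_cube c rho in iw iz E *.
pose phi := cutoff c rho (fun=> 0%N).
have mS : measurable S by exact: measurable_closed_cube.
have Sfin : (mu S < +oo)%E by rewrite lebesgue_closed_cube ?ltry// ltW.
have ia : mu.-integrable S (EFin \o cst a).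
  by apply: (integrable_bounded (M := `|a|)).
have iwa : mu.-integrable S (EFin \o (fun x => w x - a)).
  by have := integrableB mS iw ia; apply: eq_integrable.
have phi0 x : 0 <= phi x by exact: cutoff0_ge0.
have phi1 x : phi x <= 1 by exact: cutoff0_le1.
have phin1 x : S x -> `|phi x| <= 1 by move=> _; rewrite ger0_norm.
have mphi D : measurable_fun D phi by exact: measurable_cutoff.
have iphi : mu.-integrable S (EFin \o phi) by exact: (integrable_bounded (M := 1)).
have iwphi := integrable_mul_bounded mS iwa (mphi S) phin1.
have iwp := integrable_mul_bounded mS iw (mphi S) phin1.
have nwa : mu.-integrable S (EFin \o (fun x => `|w x - a|)).
  exact: (integrable_abse iwa).
have nz : mu.-integrable S (EFin \o (fun x => `|z x|)).
  exact: (integrable_abse iz).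
set B := rho^-1 ^+ mi_order beta * M ^+ n.
have cB x : S x -> `|cutoff c rho beta x| <= B.
  by move=> _; exact: cutoff_bound.
have izb := integrable_mul_bounded mS iz (measurable_cutoff c rho0 (D := S) beta) cB.
have up : `|\int[mu]_(x in S) (z x * cutoff c rho beta x)| <=
    B * \int[mu]_(x in S) `|z x|.
  rewrite (le_trans (le_normr_Rintegral mS izb))// -RintegralZl//.
  apply: le_Rintegral => //.
  - exact: (integrable_abse izb).
  - by have := integrableZl mS B nz; apply: eq_integrable.
  - by move=> x Sx; rewrite normrM mulrC ler_wpM2r// cB.
rewrite lerBlDr addrC.
have aphi : a * \int[mu]_(x in S) phi x =
    \int[mu]_(x in S) (w x * phi x) - \int[mu]_(x in S) ((w x - a) * phi x).
  rewrite -RintegralB// -RintegralZl//; apply: eq_Rintegral => x _.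
  by rewrite mulrBl opprB addrCA subrr addr0.
have lowphi : (expR (- 2) * rho) ^+ n <= \int[mu]_(x in S) phi x.
  have HS : closed_cube c (rho / 2) `<=` S.
    move=> x xc i; apply: (le_trans (xc i)); rewrite ler_pdivrMr// ler_pMr//.
    by rewrite ler1n.
  have mH := measurable_closed_cube c (rho / 2).
  apply: (@le_trans _ _ (\int[mu]_(x in closed_cube c (rho / 2)) expR (- 2) ^+ n)).
    rewrite Rintegral_cst//= lebesgue_closed_cube/=; last by rewrite divr_ge0// ltW.
    by rewrite exprMn mulrCA divff// mulr1.
  rewrite -(setIidr HS) Rintegral_mkcondr.
  have e0 : 0 <= expR (- 2) ^+ n :> R by rewrite exprn_ge0// expR_ge0.
  apply: le_Rintegral => //.
    apply: (integrable_bounded (M := expR (- 2) ^+ n)) => //.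
      by apply/(measurable_restrict _ mH mS).
    by move=> x _; rewrite patchE; case: ifP => _; rewrite ?normr0// ger0_norm.
  move=> x _; rewrite patchE; case: ifPn => // /set_mem.
  exact: cutoff0_gt.
apply: (@le_trans _ _ `|a * \int[mu]_(x in S) phi x|).
  rewrite normrM ler_wpM2l// (le_trans lowphi)// ler_norm//.
rewrite aphi (le_trans (ler_normB _ _))// E addrC lerD//.
rewrite (le_trans (le_normr_Rintegral mS iwphi))//.
apply: le_Rintegral => //.
- exact: (integrable_abse iwphi).
- by move=> x Sx; rewrite normrM ler_piMr// phin1.
Qed.

(** Replaces the Hoelder inequality: the coefficient lam^(1 - q) turns a bound lam^q on the integral
    of y^q into lam, so that over Q one gets lam (|Q| + 1), with a factor independent of q. For y >
    lam it is t <= t^q at t = y / lam. *)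
Lemma powR_young (y lam q : R) : 0 <= y -> 0 < lam -> 1 <= q ->
  y <= lam + lam / lam `^ q * y `^ q.
Proof.
move=> y0 lam0 q1; have [yl|ly] := leP y lam.
  by rewrite ler_wpDr// mulr_ge0 ?powR_ge0// divr_ge0 ?powR_ge0// ltW.
have l0 : 0 < lam `^ q by rewrite powR_gt0.
apply: (@le_trans _ _ (lam / lam `^ q * y `^ q)); last by rewrite lerDr ltW.
have -> : y = lam * (y / lam) by rewrite mulrCA divff ?gt_eqF// mulr1.
set t := y / lam; have t1 : 1 <= t by rewrite ler_pdivlMr// mul1r ltW.
rewrite powRM ?(ltW lam0)//; last by rewrite (le_trans _ t1).
rewrite mulrA divfK ?gt_eqF// ler_pM2l//.
by rewrite -[leLHS]powRr1 ?ler_powR// (le_trans _ t1).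
Qed.

(** Several cells may share an element, so a sum over cells is not a sum over elements. The function
    [Z] gathers all elements and is integrated over the disjoint cells, which counts nothing
    twice. *)
Lemma cell_sum (c0 : V) (s : R) m (p : \bar R) (T : set (set V))
    (z : set V -> V -> R) (S : {ffun 'I_n -> 'I_m} -> set V)
    (kap : {ffun 'I_n -> 'I_m} -> set V) (lam : R) :
  0 < s -> (0 < m)%N -> (1 <= p)%E -> finite_set T -> 0 < lam ->
  (forall K, T K -> measurable_fun K° (z K)) ->
  (forall k, [/\ measurable (S k), S k `<=` cube (subcorner c0 s k) s, T (kap k) &
    S k `<=` (kap k)°]) ->
  elementwise_Lp_le T p z lam ->
  (\sum_k \int[mu]_(x in S k) (`|z (kap k) x|)%:E <=
   (lam * ((s * m%:R) ^+ n + 1))%:E)%E.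
Proof.
move=> s0 m0 p1 fT lam0 mz HS Hp.
pose Q := cube c0 (s * m%:R).
have mK (K : set V) : measurable K° by apply: measurable_open; exact: open_interior.
have sm : 0 <= s * m%:R by rewrite mulr_ge0// ltW.
have muS : (\sum_k mu (S k) <= ((s * m%:R) ^+ n)%:E)%E.
  have one (D : set V) : measurable D -> (\int[mu]_(x in D) cst 1%:E x = mu D)%E.
    by move=> mD; rewrite integral_cst// mul1e.
  rewrite -(lebesgue_cube c0 sm) -(one _ (measurable_cube _ _)).
  rewrite ge0_integral_tiling//; apply: lee_sum => k _.
  rewrite (one _ (measurable_cube _ _)).
  have [mSk Sk _ _] := HS k.
  have mC := measurable_cube (subcorner c0 s k) s.
  by apply: le_measure => //; exact: mem_set.
have mzS k : measurable_fun (S k) (fun x => `|z (kap k) x|).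
  have [mSk _ Tk Sk] := HS k; apply: measurableT_comp => //.
  exact: measurable_funS (mz _ Tk).
case: p p1 Hp => [q| |//] p1 Hp; last first.
  apply: (@le_trans _ _ (\sum_k lam%:E * mu (S k))%E).
    apply: lee_sum => k _; have [mSk _ Tk Sk] := HS k.
    rewrite -integral_cst//; apply: ae_ge0_le_integral => //.
    - exact/measurable_EFinP.
    - by move=> x _; rewrite lee_fin ltW.
    - by apply: filterS (Hp _ Tk) => x zl Skx; rewrite lee_fin zl//; exact: Sk.
  rewrite -ge0_sume_distrr//.
  apply: (@le_trans _ _ (lam%:E * ((s * m%:R) ^+ n)%:E)%E).
    by apply: lee_wpmul2l => //; rewrite lee_fin ltW.
  by rewrite -EFinM lee_fin ler_pM2l// lerDl.
rewrite lee_fin in p1; have q0 : 0 < q by exact: lt_le_trans p1.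
pose C := lam / lam `^ q.
have lq0 : 0 < lam `^ q by rewrite powR_gt0.
have C0 : 0 <= C by rewrite divr_ge0 ?powR_ge0// ltW.
pose Zk K : V -> \bar R := (fun x => (`|z K x| `^ q)%:E) \_ K°.
pose Z x := (\sum_(K <- fset_set T) Zk K x)%E.
have mzq K D : T K -> measurable D -> D `<=` K° ->
    measurable_fun D (fun x => (`|z K x| `^ q)%:E).
  move=> TK mD DK; apply/measurable_EFinP.
  apply: (measurableT_comp (measurable_powR q)).
  by apply: measurableT_comp => //; exact: measurable_funS (mz _ TK).
have Zk0 K x : (0 <= Zk K x)%E.
  by apply: erestrict_ge0 => y _; rewrite lee_fin powR_ge0.
have Z0 x : (0 <= Z x)%E by apply: sume_ge0 => K _.
have mZk K : T K -> measurable_fun setT (Zk K).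
  by move=> TK; apply: (measurable_restrictT _ (mK K)).1; exact: (mzq _ _ TK (mK K)).
(* The guard makes the summand measurable for every index, not only for the elements of the mesh. *)
have ZE x : Z x = (\sum_(K <- fset_set T) (if K \in fset_set T then Zk K x else 0))%E.
  by rewrite /Z big_seq [RHS]big_seq; apply: eq_bigr => K ->.
have mZk' K : measurable_fun setT (fun x => if K \in fset_set T then Zk K x else 0%E).
  case: (boolP (K \in fset_set T)) => KT; last exact: measurable_cst.
  apply: mZk.
  by move: KT; rewrite in_fset_set// => /set_mem.
have mZ : measurable_fun setT Z.
  by rewrite (funext ZE); exact: emeasurable_sum.
have intZ : (\int[mu]_x Z x <= (lam `^ q)%:E)%E.
  under eq_integral do rewrite ZE.
  rewrite ge0_integral_sum//; last by move=> K x _; case: ifP.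
  apply: le_trans Hp; rewrite [leLHS]big_seq [leRHS]big_seq.
  by apply: lee_sum => K ->; rewrite [leRHS]integral_mkcond.
have SZ k x : S k x -> ((`|z (kap k) x| `^ q)%:E <= Z x)%E.
  have [_ _ Tk Sk] := HS k => Skx.
  rewrite /Z (bigD1_seq (kap k)) ?fset_uniq ?in_fset_set ?mem_set//=.
  rewrite {1}/Zk patchE mem_set; last exact: Sk.
  by rewrite leeDl//; apply: sume_ge0.
apply: (@le_trans _ _ (\sum_k (lam%:E * mu (S k) + C%:E * \int[mu]_(x in S k) Z x))%E).
  apply: lee_sum => k _; have [mSk _ Tk Sk] := HS k.
  have mZS : measurable_fun (S k) Z by exact: measurable_funTS.
  have mCZ : measurable_fun (S k) (fun x => C%:E * Z x)%E by exact: measurable_funeM.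
  rewrite -integral_cst// -ge0_integralZl// -ge0_integralD//; last 2 first.
  - by move=> x _; rewrite lee_fin ltW.
  - by move=> x _; rewrite mule_ge0.
  apply: ge0_le_integral => //.
  - exact/measurable_EFinP.
  - by apply: emeasurable_funD.
  - move=> x Skx; apply: (@le_trans _ _ (lam%:E + C%:E * (`|z (kap k) x| `^ q)%:E)%E).
      by rewrite -EFinM -EFinD lee_fin powR_young.
    by apply: leeD => //; apply: lee_wpmul2l; rewrite ?lee_fin//; exact: SZ.
rewrite big_split/= -!ge0_sume_distrr//; last first.
  by move=> k _; apply: integral_ge0.
have -> : lam * ((s * m%:R) ^+ n + 1) = lam * (s * m%:R) ^+ n + C * lam `^ q.
  by rewrite /C divfK ?gt_eqF// mulrDr mulr1.
rewrite EFinD !EFinM; apply: leeD; apply: lee_wpmul2l => //;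
  rewrite ?lee_fin ?(ltW lam0)//.
apply: le_trans intZ.
apply: (@le_trans _ _ (\int[mu]_(x in Q) Z x)%E); last first.
  apply: ge0_subset_integral => //; exact: measurable_cube.
rewrite /Q ge0_integral_tiling//; last exact: measurable_funTS.
apply: lee_sum => k _; have [mSk Sk _ _] := HS k.
apply: ge0_subset_integral => //; first exact: measurable_cube.
exact: measurable_funTS.
Qed.

End lower_bounds.

(** * The summed estimate on one mesh *)

Section fixed_mesh.
Variables (R : realType) (n : nat).
Local Notation V := 'rV[R]_n.
Local Notation mu := (lebesgue_rV R n).

Lemma sub_multi_index (gamma : 'I_n -> nat) j : (j <= mi_order gamma)%N ->
  exists alpha beta : 'I_n -> nat, [/\ mi_order alpha = j,
    mi_order beta = (mi_order gamma - j)%N,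
    gamma = (fun i => beta i + alpha i)%N & forall i, (beta i <= mi_order gamma)%N].
Proof.
move=> jg; suff [alpha aj ag] : exists2 alpha : 'I_n -> nat, mi_order alpha = j &
    forall i, (alpha i <= gamma i)%N.
  exists alpha, (fun i => gamma i - alpha i)%N; split=> //.
  - by rewrite -aj /mi_order -sumnB.
  - by apply/funext => i; rewrite subnK.
  - move=> i; rewrite (leq_trans (leq_subr _ _))//.
    by rewrite /mi_order (bigD1 i)//= leq_addr.
elim: j jg => [|j ih] jg; first by exists (fun=> 0%N); rewrite // /mi_order big1.
have [alpha aj ag] := ih (ltnW jg).
have [i ai] : exists i, (alpha i < gamma i)%N.
  apply: contrapT => /forallNP H; move: jg; rewrite -aj ltnNge.
  by move/negP; apply; apply: leq_sum => i _; rewrite leqNgt; apply/negP/H.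
exists (fun l => alpha l + (l == i))%N.
  rewrite /mi_order big_split/= -/(mi_order alpha) aj (bigD1 i)//= eqxx big1 ?addn1//.
  by move=> l /negPf ->.
by move=> l; have [->|li] := eqVneq l i; rewrite ?addn1 ?addn0.
Qed.

Lemma cell_sub (c : V) (s : R) m (k : {ffun 'I_n -> 'I_m}) : 0 < s ->
  cube (subcorner c s k) s `<=` cube c (s * m%:R).
Proof.
move=> s0 x xk i; have /andP[] := xk i; rewrite mxE => h1 h2.
have : 0 <= s * (k i)%:R by rewrite mulr_ge0// ltW.
have : s * (k i)%:R + s <= s * m%:R.
  by rewrite -[X in _ + X]mulr1 -mulrDr ler_pM2l// natr1 ler_nat.
by move=> *; apply/andP; split; lra.
Qed.

Lemma monomial_seq0 (a : 'I_n -> nat) (x : V) :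
  prodfun (@monomial_seq R n a) (fun=> 0%N) x = \prod_i x 0 i ^+ a i.
Proof.
by apply: eq_bigr => i _; rewrite /monomial_seq derivn0 hornerXn.
Qed.

(** Summation of [local_lower] over the m^n cells. The lower bounds on the bump integrals add up to
    (e^-2 theta)^n |Q| whatever m is, so the conclusion is useful as soon as [eta] lies below (e^-2
    theta)^n. *)
Lemma mesh_lower_bound (G : set V) (u w v : V -> R) (gamma : 'I_n -> nat)
    (r j m : nat) (T : set (set V)) (c0 : V) (s theta a eta M lam : R) (p : \bar R)
    (kap : {ffun 'I_n -> 'I_m} -> set V) (cc : {ffun 'I_n -> 'I_m} -> V) :
  open G -> weak_derivative G gamma u w ->
  0 < s -> (0 < m)%N -> 0 < theta -> 0 < lam -> 0 <= eta ->
  closed_cube c0 (s * m%:R) `<=` G ->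
  (\int[mu]_(x in cube c0 (s * m%:R)) (`|w x - a|)%:E <=
    (eta * `|a| * (s * m%:R) ^+ n)%:E)%E ->
  finite_set T -> piecewise_polynomial r T v ->
  (forall K x, T K -> K° x -> Dpartial gamma v x = 0) ->
  (forall k, [/\ T (kap k), closed_cube (cc k) (theta * s) `<=` (kap k)° &
     closed_cube (cc k) (theta * s) `<=` cube (subcorner c0 s k) s]) ->
  (forall k t, (k <= mi_order gamma)%N -> `|bumpf k t| <= M) ->
  (j <= mi_order gamma)%N -> (1 <= p)%E ->
  (piecewise_norm j p T (u \- v)%R < lam%:E)%E ->
  `|a| * (s * m%:R) ^+ n * ((expR (- 2) * theta) ^+ n - eta) <=
  (theta * s)^-1 ^+ (mi_order gamma - j) * M ^+ n * (lam * ((s * m%:R) ^+ n + 1)).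
Proof.
move=> oG wder s0 m0 theta0 lam0 eta0 QG wa fT [mv vpoly] vgamma HS bM jg p1 N.
have [alpha [beta [aj bj gE bg]]] := sub_multi_index jg.
have rho0 : 0 < theta * s by rewrite mulr_gt0.
pose S k := closed_cube (cc k) (theta * s).
have sm : 0 <= s * m%:R by rewrite mulr_ge0// ltW.
have mG := measurable_open oG.
have mu0 : (0 < mu [set: V])%E.
  apply: (@lt_le_trans _ _ (mu (cube (0 : V) 1))).
    by rewrite lebesgue_cube// expr1n.
  by apply: le_measure => //; apply: mem_set => //; exact: measurable_cube.
rewrite -aj in N.
have [zder zle] := piecewise_norm_lt p1 fT mu0 lam0 N.
pose z K := wD K° alpha (u \- v)%R.
have mK (K : set V) : measurable K° by apply: measurable_open; exact: open_interior.
have mz K : T K -> measurable_fun K° (z K).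
  by move=> /zder[_ [] ].
have SQ k : S k `<=` cube c0 (s * m%:R).
  by have [_ _ Sk] := HS k; apply: (subset_trans Sk); exact: cell_sub.
have SG k : S k `<=` G.
  by apply: subset_trans QG; apply: subset_trans (SQ k) _; exact: cube_closed_cube.
have cS k : compact (S k) by exact: compact_closed_cube.
have mS k : measurable (S k) by exact: measurable_closed_cube.
have iw k : mu.-integrable (S k) (EFin \o w).
  by have [_ [_ iw] _] := wder; exact: iw (cS k) (SG k).
have iz k : mu.-integrable (S k) (EFin \o z (kap k)).
  by have [Tk Sk _] := HS k; have [_ [_ iz] _] := zder _ Tk; exact: iz (cS k) Sk.
have low k : `|a| * (expR (- 2) * (theta * s)) ^+ n - \int[mu]_(x in S k) `|w x - a|
    <= (theta * s)^-1 ^+ mi_order beta * M ^+ n * \int[mu]_(x in S k) `|z (kap k) x|.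
  have [Tk Sk _] := HS k.
  apply: (local_lower a rho0 (iw k) (iz k)); last by move=> i t; exact: bM.
  apply: (local_identity rho0 (mK (kap k)) mG Sk (SG k) gE wder (zder _ Tk)).
  have [C vC] := vpoly _ Tk.
  pose D (l : {ffun 'I_n -> 'I_r}) := @monomial_seq R n (fun i => l i : nat).
  have HD l i : derivative_seq (D l i) by exact: derivative_seq_monomial.
  have vE x : (kap k)° x -> v x = prodfun_sum C D (fun=> 0%N) x.
    move=> Kx; rewrite vC// /prodfun_sum; apply: eq_bigr => l _.
    by rewrite /D monomial_seq0.
  have D0 x : S k x -> prodfun_sum C D gamma x = 0.
    move=> /Sk Kx; rewrite -(vgamma _ _ Tk Kx).
    rewrite (Dpartial_local gamma (open_interior _) vE Kx).
    by rewrite (Dpartial_family (F := prodfun_sum C D) _ _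
      (fun m' i => partial_prodfun_sum C m' i HD)).
  rewrite -[RHS](cutoff_orthogonal rho0 HD D0).
  by apply: eq_Rintegral => x /set_mem/Sk Kx; rewrite vE.
have sumz : \sum_k \int[mu]_(x in S k) `|z (kap k) x| <= lam * ((s * m%:R) ^+ n + 1).
  rewrite -lee_fin -sumEFin.
  have HS' k : [/\ measurable (S k), S k `<=` cube (subcorner c0 s k) s, T (kap k) &
    S k `<=` (kap k)°] by have [? ? ?] := HS k; split.
  apply: le_trans (cell_sum s0 m0 p1 fT lam0 mz HS' zle).
  apply: lee_sum => k _; rewrite /Rintegral fineK//.
  exact: (integrable_fin_num (mS k) (integrable_abse (iz k))).
have iwa k : mu.-integrable (S k) (EFin \o (fun x => w x - a)).
  have ia : mu.-integrable (S k) (EFin \o cst a).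
    have Sfin : (mu (S k) < +oo)%E by rewrite lebesgue_closed_cube ?ltry// ltW.
    by apply: (integrable_bounded (M := `|a|)).
  by have := integrableB (mS k) (iw k) ia; apply: eq_integrable.
have sumw : \sum_k \int[mu]_(x in S k) `|w x - a| <= eta * `|a| * (s * m%:R) ^+ n.
  rewrite -lee_fin -sumEFin; apply: le_trans wa.
  have mwa : measurable_fun (cube c0 (s * m%:R)) (fun x => (`|w x - a|)%:E).
    apply/measurable_EFinP; apply: measurableT_comp => //; apply: measurable_funB => //.
    have [_ [mw _] _] := wder; apply: measurable_funS mw => //.
    by apply: subset_trans QG; exact: cube_closed_cube.
  rewrite ge0_integral_tiling//.
  apply: lee_sum => k _; have [_ _ Sk] := HS k.
  rewrite /Rintegral fineK; last first.
    exact: (integrable_fin_num (mS k) (integrable_abse (iwa k))).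
  apply: ge0_subset_integral => //; first exact: measurable_cube.
  apply: measurable_funS mwa => //; first exact: measurable_cube.
  exact: cell_sub.
have := ler_sum (index_enum {ffun 'I_n -> 'I_m}) (fun k (_ : true) => low k).
rewrite -mulr_sumr sumrB -[X in X - _]/(\sum_(k : {ffun 'I_n -> 'I_m}) _).
rewrite sumr_const card_ffun !card_ord bj => H.
have HB : (theta * s)^-1 ^+ (mi_order gamma - j) * M ^+ n *
    \sum_k \int[mu]_(x in S k) `|z (kap k) x| <=
    (theta * s)^-1 ^+ (mi_order gamma - j) * M ^+ n * (lam * ((s * m%:R) ^+ n + 1)).
  apply: ler_wpM2l sumz; rewrite mulr_ge0 ?exprn_ge0 ?invr_ge0 ?(ltW rho0)//.
  by apply: le_trans (bM 0%N 0 _).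
apply: le_trans HB; apply: le_trans H.
have -> : `|a| * (expR (- 2) * (theta * s)) ^+ n *+ m ^ n =
   `|a| * (s * m%:R) ^+ n * (expR (- 2) * theta) ^+ n.
  by rewrite -[_ *+ _]mulr_natr natrX !exprMn; ring.
by rewrite mulrBr lerB// [leRHS]mulrC mulrA.
Qed.

End fixed_mesh.

Section sobolev_weak.
Variables (R : realType) (n : nat).
Local Notation V := 'rV[R]_n.

Lemma sobolev_norm_nat_lt (k : nat) (p : \bar R) (G : set V) (v : V -> R) :
  (sobolev_norm_nat k p G v < +oo)%E -> weakly_differentiable k G v.
Proof. by rewrite /sobolev_norm_nat; case: asboolP => //; rewrite ltxx. Qed.

Lemma in_sobolev_weakly_differentiable (s : R) (p : \bar R) (G : set V) (v : V -> R) :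
  (1 <= p)%E -> in_sobolev s p G v -> weakly_differentiable (Num.truncn s) G v.
Proof.
move=> p1; rewrite /in_sobolev /sobolev_norm; case: ifP => _.
  exact: sobolev_norm_nat_lt.
set F := (fun b : bool => _) => FN; apply: (@sobolev_norm_nat_lt _ p).
apply: contrapT => /negP; rewrite -leNgt leye_eq => /eqP Foo.
have fb : finite_set [set: bool] by exact: finite_finset.
have Ft : F true = +oo%E := Foo.
have := @lp_sum_ge _ _ p [set: bool] F true p1 fb.
by rewrite Ft leey leNgt FN => /(_ isT I).
Qed.

End sobolev_weak.

Lemma bump_uniform_bound (R : realType) (r : nat) :
  exists2 M : R, 0 < M & forall k t, (k <= r)%N -> `|bumpf k t : R| <= M.
Proof.
elim: r => [|r [M M0 HM]].
  have [M M0 HM] := bump_bounded R 0; exists M => // k t.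
  by rewrite leqn0 => /eqP ->.
have [N N0 HN] := bump_bounded R r.+1; exists (M + N); first exact: addr_gt0.
move=> k t; rewrite leq_eqVlt => /predU1P[->|kr].
  by rewrite (le_trans (HN t))// lerDr ltW.
by rewrite (le_trans (HM k t kr))// lerDl ltW.
Qed.

(** With m = truncn (q / h) + 1 one has m h <= q + h <= q + D. A mesh coarser than the cube is
    covered too: then m = 1, and the bound [D] on h pays for the ratio. *)
Lemma cell_side (R : realType) (q h D : R) : 0 < q -> 0 < h -> h <= D ->
  exists m : nat, [/\ (0 < m)%N, q / m%:R <= h & q / (q + D) * h <= q / m%:R].
Proof.
move=> q0 h0 hD; have /andP[t1 t2] := truncn_itv (ltW (divr_gt0 q0 h0)).
exists (Num.truncn (q / h)).+1; split=> //.
  rewrite ler_pdivrMr ?ltr0n//; move: t2; rewrite ltr_pdivrMr// => /ltW.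
  by rewrite mulrC.
have D0 : 0 < D by exact: lt_le_trans hD.
rewrite ler_pdivlMr ?ltr0n// -[X in _ * X]natr1.
have qD : 0 < q + D by rewrite addr_gt0.
have -> : q / (q + D) * h * ((Num.truncn (q / h))%:R + 1) =
    q * ((h * (Num.truncn (q / h))%:R + h) / (q + D)) by field; rewrite gt_eqF.
rewrite ler_piMr ?(ltW q0)// ler_pdivrMr// mul1r lerD//.
by rewrite mulrC -ler_pdivlMr.
Qed.

(** * Constants uniform over the family of meshes *)

Section lower_bound.
Variables (R : realType) (n : nat).
Hypothesis n_gt0 : (0 < n)%N.
Local Notation V := 'rV[R]_n.
Local Notation mu := (lebesgue_rV R n).

Lemma quasi_uniform_lower_bound (Om G : set V) (u : V -> R) (I : Type)
    (T : I -> set (set V)) (r r' : nat) (uh : I -> V -> R) (p : \bar R)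
    (gamma : 'I_n -> nat) (w : V -> R) :
  Om !=set0 -> bounded_set Om -> (forall i, face_to_face_partition Om (T i)) ->
  quasi_uniform T -> open G -> G `<=` Om -> (1 <= p)%E -> mi_order gamma = r ->
  weak_derivative G gamma u w -> (0 < Lp_norm G p w)%E ->
  (forall i, piecewise_polynomial r' (T i) (uh i)) ->
  (forall i K x, T i K -> K° x -> Dpartial gamma (uh i) x = 0) ->
  exists2 C : R, 0 < C & forall j, (j <= r)%N -> forall i,
    0 < mesh_size (T i) /\
    ((C * mesh_size (T i) ^+ (r - j))%:E <= piecewise_norm j p (T i) (u \- uh i)%R)%E.
Proof.
move=> Om0 bOm HT qu oG GOm p1 gr wder w0 pol Dg.
have [theta [D [theta0 theta1 D0 Hmesh]]] := mesh_cubes n_gt0 Om0 bOm HT qu.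
have [_ lw _] := wder.
have wpos := Lp_norm_gt0 p1 (measurable_open oG) lw.1 w0.
pose E := (expR (- 2) * theta) ^+ n.
have E0 : 0 < E by rewrite exprn_gt0// mulr_gt0// expR_gt0.
(* The tolerance E / 2 leaves half of the fraction [E] of Q seen by the bumps. *)
have [c0 [q [a [q0 a0 QG wa]]]] := L1_density_cube oG lw wpos (divr_gt0 E0 (ltr0n R 2)).
have [M M0 HM] := bump_uniform_bound R r.
pose C1 := q / (q + D).
have qD0 : 0 < q + D by rewrite addr_gt0.
have C10 : 0 < C1 by rewrite divr_gt0.
have C11 : C1 <= 1 by rewrite ler_pdivrMr// mul1r lerDl ltW.
have tC0 : 0 < theta * C1 by rewrite mulr_gt0.
have tC1 : theta * C1 <= 1 by rewrite mulr_ile1// ltW.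
have an0 : 0 < `|a| by rewrite normr_gt0.
have qn0 : 0 < q ^+ n by rewrite exprn_gt0.
have Mn0 : 0 < M ^+ n by rewrite exprn_gt0.
(* The value at which the two sides of [mesh_lower_bound] would meet after bounding h / s; halving
   it below gives a strict contradiction. *)
pose C2 := `|a| * q ^+ n * (E / 2) * (theta * C1) ^+ r / (M ^+ n * (q ^+ n + 1)).
have C20 : 0 < C2.
  apply: divr_gt0; last by rewrite mulr_gt0// addr_gt0.
  apply: mulr_gt0; last by rewrite exprn_gt0.
  by apply: mulr_gt0; [rewrite mulr_gt0|rewrite divr_gt0].
exists (C2 / 2); first by rewrite divr_gt0.
move=> j jr i; have [/andP[h0 hD] Hcell] := Hmesh i.
set h := mesh_size (T i) in h0 hD Hcell *; split=> //.
have hr0 : 0 < h ^+ (r - j) by rewrite exprn_gt0.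
rewrite leNgt; apply/negP => N.
have [m [m0 sh hs]] := cell_side q0 h0 hD.
set s := q / m%:R in sh hs.
have mR : 0 < m%:R :> R by rewrite ltr0n.
have s0 : 0 < s by rewrite divr_gt0.
have smq : s * m%:R = q by rewrite /s divfK// gt_eqF.
have Hk (k : {ffun 'I_n -> 'I_m}) : exists Kc : set V * V,
    [/\ T i Kc.1, closed_cube Kc.2 (theta * s) `<=` Kc.1° &
     closed_cube Kc.2 (theta * s) `<=` cube (subcorner c0 s k) s].
  (* The centre of the cell: strict distance less than s / 2 from it keeps a point inside the
     half-open cell. *)
  pose x : V := subcorner c0 s k + const_mx (s / 2).
  have xk : cube (subcorner c0 s k) s x.
    move=> l; rewrite !mxE; apply/andP; split; first by rewrite lerDl divr_ge0// ltW.
    by rewrite ltrD2l ltr_pdivrMr// ltr_pMr// ltr1n.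
  have Omx : Om x.
    apply/GOm/QG/cube_closed_cube; rewrite -smq; exact: cell_sub xk.
  have [K [c [TK cK cx]]] := Hcell x s Omx (introT andP (conj s0 sh)).
  exists (K, c); split=> //= y /cx yx l; have := yx l.
  rewrite !mxE ltr_distl => /andP[y1 y2]; apply/andP; split; lra.
have {Hk}[kc Hkc] := choice Hk.
have lam0 : 0 < C2 / 2 * h ^+ (r - j) by rewrite mulr_gt0// divr_gt0.
have [fT _ _ _] := HT i.
have := @mesh_lower_bound R n G u w (uh i) gamma r' j m (T i) c0 s theta a (E / 2) M
  (C2 / 2 * h ^+ (r - j)) p (fun k => (kc k).1) (fun k => (kc k).2)
  oG wder s0 m0 theta0 lam0 (ltW (divr_gt0 E0 (ltr0n R 2))).
rewrite smq gr => /(_ QG wa fT (pol i) (fun K x => Dg i K x) Hkc HM jr p1 N).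
rewrite -/E (_ : E - E / 2 = E / 2); last by field.
apply/negP; rewrite -ltNge.
have rho0 : 0 < theta * s by rewrite mulr_gt0.
(* As s >= C1 h, the powers of h cancel. Since theta C1 <= 1, the exponent r - j may be replaced by
   r, which makes the constant common to all j. *)
have key : (theta * s)^-1 ^+ (r - j) * h ^+ (r - j) <= ((theta * C1) ^+ r)^-1.
  rewrite -exprMn -[leRHS]exprVn.
  apply: (@le_trans _ _ ((theta * C1)^-1 ^+ (r - j))).
    rewrite lerXn2r ?nnegrE ?mulr_ge0 ?invr_ge0 ?(ltW rho0) ?(ltW h0) ?(ltW tC0)//.
    rewrite ler_pdivrMl// ler_pdivlMr// mulrC -mulrA ler_pM2l//.
  by rewrite ler_weXn2l ?leq_subr// invf_ge1.
apply: (@le_lt_trans _ _ (((theta * C1) ^+ r)^-1 * (M ^+ n * (q ^+ n + 1)) * (C2 / 2))).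
  have -> : (theta * s)^-1 ^+ (r - j) * M ^+ n *
      (C2 / 2 * h ^+ (r - j) * (q ^+ n + 1)) =
    ((theta * s)^-1 ^+ (r - j) * h ^+ (r - j)) *
      (M ^+ n * (q ^+ n + 1)) * (C2 / 2) by ring.
  rewrite -[leLHS]mulrA -[leRHS]mulrA ler_wpM2r//.
  have X0 : 0 < M ^+ n * (q ^+ n + 1) * (C2 / 2).
    by apply: mulr_gt0; [apply: mulr_gt0; rewrite ?addr_gt0|rewrite divr_gt0].
  exact: ltW.
have -> : ((theta * C1) ^+ r)^-1 * (M ^+ n * (q ^+ n + 1)) * (C2 / 2) =
    `|a| * q ^+ n * (E / 2) / 2.
  by rewrite /C2; field; rewrite !gt_eqF ?addr_gt0 ?exprn_gt0.
rewrite ltr_pdivrMr// ltr_pMr ?ltr1n//.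
by apply: mulr_gt0; [rewrite mulr_gt0|rewrite divr_gt0].
Qed.

End lower_bound.

Theorem corollary3p1 (R : realType) (n : nat) (n_gt0 : (0 < n)%N)
  (Om : set 'rV[R]_n) (Om_dom : polytopic_lipschitz_domain Om)
  (f u : 'rV[R]_n -> R) (f_L2 : in_L2 Om f) (u_sol : poisson_solution Om f u)
  (I : Type) (T : I -> set (set 'rV[R]_n))
  (T_mesh : forall i, face_to_face_partition Om (T i))
  (r : nat) (r_gt0 : (0 < r)%N)
  (Vh : I -> set ('rV[R]_n -> R)) (Vh_fe : forall i, fe_space r (T i) (Vh i))
  (uh : I -> 'rV[R]_n -> R)
  (uh_sol : forall i, fe_solution Om (T i) (Vh i) f (uh i))
  (p : \bar R) (p_ge1 : (1 <= p)%E)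
  (G : set 'rV[R]_n) (G_dom : domain G) (G_in : compactly_inside G Om)
  (delta : R) (delta_gt0 : 0 < delta)
  (u_reg : in_sobolev (r%:R + delta) p G u)
  (gamma : 'I_n -> nat) (gamma_r : mi_order gamma = r)
  (u_gamma : (0 < Lp_norm G p (wD G gamma u))%E)
  (Vh_gamma : forall i v K x, Vh i v -> T i K -> K° x -> Dpartial gamma v x = 0)
  (T_qu : quasi_uniform T) :
  (exists2 C : R, 0 < C & forall j, (j <= r)%N -> forall i,
     ((C * mesh_size (T i) ^+ (r - j))%:E
      <= piecewise_norm j p (T i) (u \- uh i)%R)%E)
  /\
  ((1 < p)%E -> (p < +oo)%E ->
   (forall e : R, 0 < e -> exists i, mesh_size (T i) < e) ->
   (forall (l : nat) (s : R), (l <= 1)%N -> 0 < s <= r%:R ->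
      error_estimate Om u T uh p l s) ->
   forall l : nat, (l <= 1)%N -> optimal_error_estimate Om u T uh p l r%:R).
Proof.
have [Om_open bOm _ _] := Om_dom; have [Om0 _ _] := Om_open.
have [_ oG _] := G_dom; have [GOm _ _] := G_in.
have pol i : piecewise_polynomial r (T i) (uh i).
  by have [_ _ H] := Vh_fe i; apply: H; have [] := uh_sol i.
have Dg i K x : T i K -> K° x -> Dpartial gamma (uh i) x = 0.
  by move=> TK Kx; apply: (Vh_gamma i (uh i) K x) => //; have [] := uh_sol i.
have wd := in_sobolev_weakly_differentiable p_ge1 u_reg.
(* The Sobolev order r + delta has integer part at least r, so the weak derivative of index gamma
   exists on G. *)
have rk : (mi_order gamma <= Num.truncn (r%:R + delta))%N.
  have rd0 : 0 <= r%:R + delta by rewrite addr_ge0// ltW.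
  by rewrite gamma_r truncn_ge_nat// lerDl ltW.
have wder := weak_derivative_wD wd rk.
have [C C0 lower] := quasi_uniform_lower_bound n_gt0 Om0 bOm T_mesh T_qu oG GOm
  p_ge1 gamma_r wder u_gamma pol Dg.
split; first by exists C => // j jr i; have [] := lower j jr i.
move=> p1 poo small est l l1; split.
  by apply: est => //; rewrite ltr0n r_gt0 lexx.
move=> omega omega0 bound.
have lr : (l <= r)%N by exact: leq_trans l1 r_gt0.
(* A bound of higher order eventually drops below C t^(r - l), and some mesh of the family is fine
   enough to contradict the lower bound. *)
have : \forall t \near 0^'+, `|omega t / t `^ (r%:R - l%:R)| < C.
  exact: cvgr0_norm_lt omega0 _ C0.
move=> [e /= e0 He]; have [i ie] := small e e0.
have [h0 low] := lower l lr i; set h := mesh_size (T i) in h0 low ie.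
have := He h; rewrite /= sub0r normrN gtr0_norm// => /(_ ie h0).
have hE : h `^ (r%:R - l%:R) = h ^+ (r - l) by rewrite -natrB// powR_mulrn// ltW.
have hr0 : 0 < h ^+ (r - l) by rewrite exprn_gt0.
rewrite hE normrM normfV [X in _ / X]gtr0_norm// ltr_pdivrMr// ltNge => /negP; apply.
have := le_trans low (bound i); rewrite lee_fin => /le_trans; apply.
exact: ler_norm.
Qed.
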